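(* Let $E$ be an elliptic curve over a number field $K$ given by a Weierstrass equation with coefficients in $\mathcal{O}_K$, with complex multiplication by $\mathrm{End}(E)=\mathbb{Z}[\omega]$. Let $P\in E(K)$ be non-torsion, let $D_\alpha=D_{[\alpha]P}$ be the denominator ideals and $\psi_\alpha=\psi_\alpha(P)\in K$ for $\alpha\in\mathbb{Z}[\omega]$. Let $\alpha,\beta,\gamma\in\mathbb{Z}[\omega]$ and suppose at least two of them belong to $\mathfrak{M}(P)$, and suppose further that either (a) $\mathbb{Z}[\omega]$ is a principal ideal domain, or (b) there exists $M\in\mathfrak{M}(P)$ such that each of $\alpha,\beta,\gamma$ is either a multiple of $M$ or coprime to $M$. Then there is a sequence $\{\mathfrak{g}_\alpha\}_{\alpha\in\mathbb{Z}[\omega]}$ of (fractional) ideals of $\mathcal{O}_K$ with \[ D_\alpha=\psi_\alpha\mathfrak{g}_\alpha^{-1},\qquad \psi_{\alpha+\beta}\psi_{\alpha-\beta}\psi_\gamma^2=\psi_{\alpha+\gamma}\psi_{\alpha-\gamma}\psi_\beta^2-\psi_{\beta+\gamma}\psi_{\beta-\gamma}\psi_\alpha^2, \] \[ \mathfrak{g}_{\alpha+\beta}\mathfrak{g}_{\alpha-\beta}\mathfrak{g}_\gamma^2=\mathfrak{g}_{\alpha+\gamma}\mathfrak{g}_{\alpha-\gamma}\mathfrak{g}_\beta^2=\mathfrak{g}_{\beta+\gamma}\mathfrak{g}_{\beta-\gamma}\mathfrak{g}_\alpha^2. \]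
   Context: The Weierstrass equation is $y^2+a_1xy+a_3y=x^3+a_2x^2+a_4x+a_6$, $a_i\in\mathcal O_K$, discriminant $\Delta$; $\mathbb{Z}[\omega]$ is an order of an imaginary quadratic field $F\subseteq K$, endomorphisms defined over $K$. For $Q\in E(K)\setminus\{O\}$, $x(Q)\mathcal{O}_K=A_QD_Q^{-2}$ with $A_Q,D_Q$ coprime integral ideals. $D_\alpha=\psi_\alpha\mathfrak g_\alpha^{-1}$ means $D_\alpha=(\psi_\alpha\mathcal{O}_K)\mathfrak g_\alpha^{-1}$. Net polynomials: for $P_1,P_2\in E(K)\setminus\{O\}$, $P_i=(x_i,y_i)$, $x_1\ne x_2$, $\Psi_{\mathbf v}(P_1,P_2)$ ($\mathbf v\in\mathbb Z^2$) is the unique map $W:\mathbb Z^2\to K$ with $W(\mathbf 0)=0$ satisfying $W(\mathbf p+\mathbf q+\mathbf s)W(\mathbf p-\mathbf q)W(\mathbf r+\mathbf s)W(\mathbf r)+W(\mathbf q+\mathbf r+\mathbf s)W(\mathbf q-\mathbf r)W(\mathbf p+\mathbf s)W(\mathbf p)+W(\mathbf r+\mathbf p+\mathbf s)W(\mathbf r-\mathbf p)W(\mathbf q+\mathbf s)W(\mathbf q)=0$ for all $\mathbf p,\mathbf q,\mathbf r,\mathbf s$, with $\Psi_{\mathbf e_i}=1$, $\Psi_{2\mathbf e_i}=2y_i+a_1x_i+a_3$, $\Psi_{\mathbf e_1+\mathbf e_2}=1$, $\Psi_{2\mathbf e_i+\mathbf e_j}=2x_i+x_j-\lambda^2-a_1\lambda+a_2$,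 $\lambda=(y_j-y_i)/(x_j-x_i)$ ($i\ne j$). For $\alpha=a+b\omega$, $\psi_\alpha(P)=\Psi_{(a,b)}(P,[\omega]P)$. $\mathfrak{M}(P)$: for each prime $\mathfrak p$ with completion $K_\nu$, let $\mathfrak a(\mathfrak p,P)$ be the annihilator in $\mathbb Z[\omega]$ of the class of $P$ in the $\mathbb Z[\omega]$-module $E(K_\nu)/E_0(K_\nu)$, where $E_0$ denotes points with non-singular reduction mod $\mathfrak p$; $\mathfrak M(P)$ is the least common multiple (intersection) of all $\mathfrak a(\mathfrak p,P)$ (equivalently over $\mathfrak p\mid\Delta$). *)

(* Defs.v *)
From mathcomp Require Import all_boot all_order all_algebra all_field.
From mathcomp Require Import mpoly.
From mathcomp Require Import classical_sets.

Set Implicit Arguments.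
Unset Strict Implicit.
Unset Printing Implicit Defensive.

Import Order.TTheory GRing.Theory Num.Theory.

Local Open Scope classical_set_scope.
Local Open Scope ring_scope.

(* Subrings of a field, their ideals and fractional ideals are all subsets of
   the field. *)
Section Ideals.
Variable F : fieldType.
Implicit Types (R I J p : set F) (c w x y z : F).

Definition ring_of_integers : set F :=
  [set x | integralOver (intr : int -> F) x].

Definition Zadjoin w : set F :=
  [set x | exists a b : int, x = a%:~R + b%:~R * w].

(* w generates an order in an imaginary quadratic subfield. *)
Definition imaginary_quadratic_integer w : Prop :=
  exists t n : int, w ^+ 2 - t%:~R * w + n%:~R = 0 /\ t ^+ 2 - 4 * n < 0.

Definition submodule R I : Prop :=
  [/\ I 0, forall x y, I x -> I y -> I (x + y)
    & forall x y, R x -> I y -> I (x * y)].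

Definition ideal R I : Prop := I `<=` R /\ submodule R I.

Definition nonzero I : Prop := exists2 x, I x & x <> 0.

(* Nonzero, as fractional ideals are inverted below. *)
Definition fractional_ideal R I : Prop :=
  [/\ submodule R I, nonzero I
    & exists d, [/\ R d, d <> 0 & forall x, I x -> R (d * x)]].

Definition principal R c : set F := [set x | exists2 y, R y & x = c * y].

Definition ideal_add I J : set F :=
  [set z | exists x y, [/\ I x, J y & z = x + y]].

Definition ideal_mul I J : set F :=
  [set z | exists n (u v : 'I_n -> F),
     [/\ forall i, I (u i), forall i, J (v i) & z = \sum_(i < n) u i * v i]].

Definition ideal_inv R I : set F := [set x | forall y, I y -> R (x * y)].

Definition is_pid R : Prop :=
  forall I, ideal R I -> exists2 c, R c & I = principal R c.

Definition multiple_of R x y : Prop := exists2 d, R d & x = d * y.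

Definition coprime_in R x y : Prop :=
  ideal_add (principal R x) (principal R y) = R.

Definition nonzero_prime_ideal R p : Prop :=
  [/\ ideal R p, nonzero p, ~ p 1
    & forall x y, R x -> R y -> p (x * y) -> p x \/ p y].

(* The localization R_p and its maximal ideal p R_p. *)
Definition localization R p : set F :=
  [set x | exists a b, [/\ R a, R b, ~ p b & x = a / b]].

Definition local_maximal_ideal R p : set F :=
  [set x | exists a b, [/\ p a, R b, ~ p b & x = a / b]].

End Ideals.

Record weierstrass (F : Type) := Weierstrass
  { a1 : F; a2 : F; a3 : F; a4 : F; a6 : F }.

Inductive ec_point (F : Type) := Infinity | Affine (x y : F).
Arguments Infinity {F}.

Definition map_weierstrass (F L : Type) (f : F -> L) (E : weierstrass F) :=
  Weierstrass (f (a1 E)) (f (a2 E)) (f (a3 E)) (f (a4 E)) (f (a6 E)).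

Definition map_point (F L : Type) (f : F -> L) (Q : ec_point F) : ec_point L :=
  if Q is Affine x y then Affine (f x) (f y) else Infinity.

Section Curve.
Variables (F : fieldType) (E : weierstrass F).
Implicit Types (P Q : ec_point F) (x y : F).

Definition discriminant : F :=
  let b2 := a1 E ^+ 2 + 4 * a2 E in
  let b4 := 2 * a4 E + a1 E * a3 E in
  let b6 := a3 E ^+ 2 + 4 * a6 E in
  let b8 := a1 E ^+ 2 * a6 E + 4 * a2 E * a6 E - a1 E * a3 E * a4 E
            + a2 E * a3 E ^+ 2 - a4 E ^+ 2 in
  - b2 ^+ 2 * b8 - 8 * b4 ^+ 3 - 27 * b6 ^+ 2 + 9 * b2 * b4 * b6.

Definition on_curve Q : Prop :=
  if Q is Affine x y then
    y ^+ 2 + a1 E * x * y + a3 E * y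
    = x ^+ 3 + a2 E * x ^+ 2 + a4 E * x + a6 E
  else True.

Definition add_point P Q : ec_point F :=
  match P, Q with
  | Infinity, _ => Q
  | _, Infinity => P
  | Affine x1 y1, Affine x2 y2 =>
    if (x1 == x2) && (y1 + y2 + a1 E * x2 + a3 E == 0) then Infinity else
    let l := if x1 == x2
      then (3 * x1 ^+ 2 + 2 * a2 E * x1 + a4 E - a1 E * y1)
           / (2 * y1 + a1 E * x1 + a3 E)
      else (y2 - y1) / (x2 - x1) in
    let x3 := l ^+ 2 + a1 E * l - a2 E - x1 - x2 in
    Affine x3 (- (l * (x3 - x1) + y1) - a1 E * x3 - a3 E)
  end.

Definition torsion P : Prop :=
  exists n : nat, (0 < n)%N /\ iter n (add_point P) Infinity = Infinity.

(* A point that is not p-integral reduces to the point at infinity, which is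
   always smooth; an affine point reduces to a singular point iff both partial
   derivatives of the equation vanish there. *)
Definition nonsingular_reduction (p : set F) Q : Prop :=
  if Q is Affine x y then
    localization (@ring_of_integers F) p x ->
    localization (@ring_of_integers F) p y ->
    ~ (local_maximal_ideal (@ring_of_integers F) p
         (a1 E * y - 3 * x ^+ 2 - 2 * a2 E * x - a4 E) /\
       local_maximal_ideal (@ring_of_integers F) p
         (2 * y + a1 E * x + a3 E))
  else True.

(* x(Q) O_K = A D^-2 with A and D coprime integral ideals (A = 0, D = O_K when
   x(Q) = 0), and the usual convention D_O = 0 at the point at infinity. *)
Definition is_denominator Q (D : set F) : Prop :=
  let OK := @ring_of_integers F in
  if Q is Affine x _ then
    [/\ ideal OK D, nonzero D
      & exists A, [/\ ideal OK A, ideal_add A D = OK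
          & principal OK x
            = ideal_mul A (ideal_mul (ideal_inv OK D) (ideal_inv OK D))]]
  else D = [set 0].

(* W v = Psi_v (P1, P2). *)
Definition is_net_polynomials P1 P2 (W : int * int -> F) : Prop :=
  match P1, P2 with
  | Affine x1 y1, Affine x2 y2 =>
    let l := (y2 - y1) / (x2 - x1) in
    x1 <> x2 /\
    W 0 = 0 /\
    (forall p q r s : int * int,
       W (p + q + s) * W (p - q) * W (r + s) * W r
       + W (q + r + s) * W (q - r) * W (p + s) * W p
       + W (r + p + s) * W (r - p) * W (q + s) * W q = 0) /\
    (W (1, 0) = 1 /\ W (0, 1) = 1 /\ W (1, 1) = 1) /\
    W (2, 0) = 2 * y1 + a1 E * x1 + a3 E /\
    W (0, 2) = 2 * y2 + a1 E * x2 + a3 E /\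
    W (2, 1) = 2 * x1 + x2 - l ^+ 2 - a1 E * l + a2 E /\
    W (1, 2) = 2 * x2 + x1 - l ^+ 2 - a1 E * l + a2 E
  | _, _ => False
  end.

(* psi_(a + b w) = Psi_(a, b) (P, [w] P), where wP = [w] P. *)
Definition is_psi (w : F) P (wP : ec_point F) (psi : F -> F) : Prop :=
  exists2 W, is_net_polynomials P wP W
    & forall a b : int, psi (a%:~R + b%:~R * w) = W (a, b).

End Curve.

Section Endomorphisms.
Variables (F L : fieldType) (f : {rmorphism F -> L}) (E : weierstrass L).

Definition proj_coord (Q : ec_point L) (i : 'I_3) : L :=
  if Q is Affine x y then [:: x; y; 1]`_i else [:: 0; 1; 0]`_i.

Definition eval_triple (h : 'I_3 -> {mpoly F[3]}) (Q : ec_point L) (i : 'I_3) : L :=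
  (map_mpoly f (h i)).@[proj_coord Q].

(* phi is an endomorphism of E (a morphism of curves fixing the origin)
   defined over F: around each point of E(L), where L is algebraically closed,
   it is given by three forms of the same degree over F. *)
Definition is_endomorphism (phi : ec_point L -> ec_point L) : Prop :=
  [/\ phi Infinity = Infinity,
      forall Q, on_curve E Q -> on_curve E (phi Q)
    & forall Q, on_curve E Q ->
      exists (d : nat) (h : 'I_3 -> {mpoly F[3]}),
        [/\ forall i, h i \is d.-homog,
            exists i, eval_triple h Q i <> 0
          & forall Q', on_curve E Q' -> (exists i, eval_triple h Q' i <> 0) ->
            exists2 c : L, c <> 0
              & forall i, eval_triple h Q' i = c * proj_coord (phi Q') i]].

End Endomorphisms.

(* A ring isomorphism alpha |-> [alpha] from Z[w] to End(E), with all
   endomorphisms defined over K. Here iota embeds K into its algebraic closure;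
   only the values at alpha in Z[w] and at points of E are meaningful. *)
Record cm_structure (K : fieldExtType rat) (iota : {rmorphism K -> algC})
    (E : weierstrass K) (w : K) := CMStructure {
  (* [alpha] on E(algC) and its restriction to E(K) *)
  cm_geom : K -> ec_point algC -> ec_point algC;
  cm_act : K -> ec_point K -> ec_point K;
  cm_endo : forall a, Zadjoin w a ->
    is_endomorphism iota (map_weierstrass iota E) (cm_geom a);
  cm_inj : forall a b, Zadjoin w a -> Zadjoin w b ->
    (forall Q, on_curve (map_weierstrass iota E) Q ->
       cm_geom a Q = cm_geom b Q) -> a = b;
  cm_surj : forall phi,
    is_endomorphism (idfun : {rmorphism algC -> algC})
      (map_weierstrass iota E) phi ->
    exists2 a, Zadjoin w a
      & forall Q, on_curve (map_weierstrass iota E) Q -> phi Q = cm_geom a Q;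
  cm_one : forall Q, on_curve (map_weierstrass iota E) Q -> cm_geom 1 Q = Q;
  cm_add : forall a b Q, Zadjoin w a -> Zadjoin w b ->
    on_curve (map_weierstrass iota E) Q ->
    cm_geom (a + b) Q
    = add_point (map_weierstrass iota E) (cm_geom a Q) (cm_geom b Q);
  cm_mul : forall a b Q, Zadjoin w a -> Zadjoin w b ->
    on_curve (map_weierstrass iota E) Q ->
    cm_geom (a * b) Q = cm_geom a (cm_geom b Q);
  cm_restrict : forall a Q, Zadjoin w a -> on_curve E Q ->
    map_point iota (cm_act a Q) = cm_geom a (map_point iota Q)
}.

Section MP.
Variables (K : fieldExtType rat) (iota : {rmorphism K -> algC}).
Variables (E : weierstrass K) (w : K) (cm : cm_structure iota E w).

(* The class of P in E(K_p)/E_0(K_p) is killed by a iff [a]P lies in E_0(K_p);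
   as [a]P is in E(K), this only involves the local ring of O_K at p. *)
Definition annihilator (p : set K) (P : ec_point K) : set K :=
  [set a | Zadjoin w a /\ nonsingular_reduction E p (cm_act cm a P)].

Definition lcm_annihilators (P : ec_point K) : set K :=
  \bigcap_(p in nonzero_prime_ideal (@ring_of_integers K)) annihilator p P.

End MP.

(* Main.v *)
(* For a prime p the quotient t_a = psi_a / d_a, where d_a generates D_a
   locally at p, is up to units a "quadratic" function of a: the net relation
   gives
     psi_(a+b) psi_(a-b) = psi_a^2 psi_b^2 (x([b]P) - x([a]P)),
   and (x(Q) - x(R))^2 D_Q^4 D_R^4 = D_(Q+R)^2 D_(Q-R)^2 at p as soon as one of Q, R
   has nonsingular reduction, because the biquadratic forms expressing the sum
   and the product of x(Q+R), x(Q-R) through x(Q), x(R) have no common zero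
   modulo p.  So t_(a+b) t_(a-b) t_c^2 agrees up to a unit with (t_a t_b t_c)^2
   when [a]P or [b]P is nonsingular at p.  This expression is symmetric in a, b, c, and
   among any two of alpha, beta, gamma at least one belongs to M(P).  The equality
   of ideals follows from the local ones.

   Associativity of the group law is never used: the points [a]P are only added
   inside the orbit of P, where [a + b]P = [a]P + [b]P is part of the CM structure. *)
Require Import Defs.
From mathcomp Require Import all_boot all_order all_algebra all_field.
From mathcomp Require Import classical_sets boolp ring lra zify.

Set Implicit Arguments.
Unset Strict Implicit.
Unset Printing Implicit Defensive.

Import Order.TTheory GRing.Theory Num.Theory.

Local Open Scope classical_set_scope.
Local Open Scope ring_scope.

(** * Chords and tangents *)


(** The net is given only by its recurrence and a few values near the origin. Nonvanishing of psi
    and the formula for psi_(a+b) psi_(a-b) are therefore spread over Z^2 by induction along lines,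
    each step resting on one identity between abscissae. The ideals D_a need not be principal, and
    D_a is visible only through x([a]P), which gives D_a^2. Local statements are therefore proved
    for squares; roots are extracted because the local rings of O_K are valuation rings, which in
    turn is deduced from linear dependence over Z of the powers of an element. The formula in
    x([b]P) - x([a]P) degenerates for a = b and a = -b, where duplication takes its place. At 0 the
    equation D_0 = psi_0 g_0^-1 reads 0 = 0 and leaves g_0 free; g_0 = O_K makes the quadratic law
    hold there too. *)

Section ChordTangent.
Variables (F : fieldType) (E : weierstrass F).
Implicit Types (x y : F).

Definition b2 : F := a1 E ^+ 2 + 4 * a2 E.
Definition b4 : F := 2 * a4 E + a1 E * a3 E.
Definition b6 : F := a3 E ^+ 2 + 4 * a6 E.
Definition b8 : F :=
  a1 E ^+ 2 * a6 E + 4 * a2 E * a6 E - a1 E * a3 E * a4 E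
  + a2 E * a3 E ^+ 2 - a4 E ^+ 2.

Definition psi2 x y : F := 2 * y + a1 E * x + a3 E.
Definition tangent_num x y : F :=
  3 * x ^+ 2 + 2 * a2 E * x + a4 E - a1 E * y.
Definition third_x (l x1 x2 : F) : F := l ^+ 2 + a1 E * l - a2 E - x1 - x2.
Definition chord_x x1 y1 x2 y2 : F := third_x ((y2 - y1) / (x2 - x1)) x1 x2.
Definition double_x x y : F := third_x (tangent_num x y / psi2 x y) x x.
Definition opp_y x y : F := - y - a1 E * x - a3 E.

(** Numerators, over the denominator (x2 - x1)^2, of the sum and the product of x(P1 + P2) and x(P1
    - P2). On the diagonal they become the denominator and the numerator of the duplication
    formula. *)
Definition sum_form x1 x2 : F :=
  2 * x1 ^+ 2 * x2 + 2 * x1 * x2 ^+ 2 + b2 * x1 * x2 + b4 * (x1 + x2) + b6.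
Definition prod_form x1 x2 : F :=
  x1 ^+ 2 * x2 ^+ 2 - b4 * x1 * x2 - b6 * (x1 + x2) - b8.

(** Solving the curve equations for [a6], and for [a4] once two abscissae differ, turns identities
    on the curve into free rational identities that [ring] and [field] decide. *)
Lemma curve_a6 x y : on_curve E (Affine x y) ->
  a6 E = y ^+ 2 + a1 E * x * y + a3 E * y - x ^+ 3 - a2 E * x ^+ 2 - a4 E * x.
Proof. by move=> /= ->; ring. Qed.

Lemma curve_a4 x1 y1 x2 y2 : x2 - x1 != 0 ->
  on_curve E (Affine x1 y1) -> on_curve E (Affine x2 y2) ->
  a4 E = ((y2 ^+ 2 + a1 E * x2 * y2 + a3 E * y2 - x2 ^+ 3 - a2 E * x2 ^+ 2)
         - (y1 ^+ 2 + a1 E * x1 * y1 + a3 E * y1 - x1 ^+ 3 - a2 E * x1 ^+ 2))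
         / (x2 - x1).
Proof.
move=> n12 /curve_a6 h1 /curve_a6; rewrite h1 => h2.
apply: (mulIf n12); rewrite divfK //.
apply/eqP; rewrite -subr_eq0; apply/eqP.
by move/eqP: h2; rewrite -subr_eq0 => /eqP <-; ring.
Qed.

Lemma chord_x_sum x1 y1 x2 y2 : x2 - x1 != 0 ->
  on_curve E (Affine x1 y1) -> on_curve E (Affine x2 y2) ->
  (x2 - x1) ^+ 2 * (chord_x x1 y1 x2 y2 + chord_x x1 (opp_y x1 y1) x2 y2)
    = sum_form x1 x2.
Proof.
move=> n12 h1 h2.
rewrite /sum_form /b6 (curve_a6 h1) /b4 (curve_a4 n12 h1 h2).
by rewrite /chord_x /third_x /opp_y /b2; field.
Qed.

Lemma chord_x_prod x1 y1 x2 y2 : x2 - x1 != 0 ->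
  on_curve E (Affine x1 y1) -> on_curve E (Affine x2 y2) ->
  (x2 - x1) ^+ 2 * (chord_x x1 y1 x2 y2 * chord_x x1 (opp_y x1 y1) x2 y2)
    = prod_form x1 x2.
Proof.
move=> n12 h1 h2.
rewrite /prod_form /b8 /b6 (curve_a6 h1) /b4 (curve_a4 n12 h1 h2).
by rewrite /chord_x /third_x /opp_y; field.
Qed.

Lemma chord_x_diff x1 y1 x2 y2 : x2 - x1 != 0 ->
  (x2 - x1) ^+ 2 * (chord_x x1 y1 x2 y2 - chord_x x1 (opp_y x1 y1) x2 y2)
    = - (psi2 x1 y1 * psi2 x2 y2).
Proof.
by move=> n12; rewrite /chord_x /third_x /opp_y /psi2; field.
Qed.

Lemma sum_form_diag x y : on_curve E (Affine x y) ->
  sum_form x x = psi2 x y ^+ 2.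
Proof.
move=> h; rewrite /sum_form /b6 (curve_a6 h) /b4 /b2 /psi2; ring.
Qed.

Lemma prod_form_diag x y : on_curve E (Affine x y) ->
  prod_form x x = tangent_num x y ^+ 2 + a1 E * tangent_num x y * psi2 x y
                  - (a2 E + 2 * x) * psi2 x y ^+ 2.
Proof.
move=> h; rewrite /prod_form /b8 /b6 (curve_a6 h) /b4 /psi2 /tangent_num.
ring.
Qed.

Lemma double_xE x y : psi2 x y != 0 -> on_curve E (Affine x y) ->
  double_x x y * psi2 x y ^+ 2 = prod_form x x.
Proof.
move=> n h; rewrite (prod_form_diag h) /double_x /third_x.
by move: (tangent_num x y) (psi2 x y) n => n p p0; field.
Qed.

(** The identity behind the induction on the net: it links P2 - P1, P2 + P1 and 2 P1 through their
    abscissae alone. *)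
Lemma chord_x_step x1 y1 x2 y2 : x2 - x1 != 0 -> psi2 x1 y1 != 0 ->
  on_curve E (Affine x1 y1) -> on_curve E (Affine x2 y2) ->
  (x1 - chord_x x1 y1 x2 y2) * (x1 - chord_x x1 (opp_y x1 y1) x2 y2)
    * (x1 - x2) ^+ 2
  = psi2 x1 y1 ^+ 2 * (double_x x1 y1 - x2).
Proof.
move=> n12 n1 h1 h2.
(* This is (x2 - x1)^2 times the quadratic polynomial whose roots are the two chord abscissae,
   evaluated at x1. Its x2^2 terms cancel, leaving [prod_form x1 x1 - x2 * sum_form x1 x1]. *)
transitivity (prod_form x1 x2 - x1 * sum_form x1 x2
              + x1 ^+ 2 * (x2 - x1) ^+ 2).
  by rewrite -(chord_x_sum n12 h1 h2) -(chord_x_prod n12 h1 h2); ring.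
rewrite mulrBr [_ * double_x _ _]mulrC (double_xE n1 h1) -(sum_form_diag h1).
by rewrite /prod_form /sum_form /b8 /b6 (curve_a6 h1) /b4 /b2; ring.
Qed.

End ChordTangent.

(** * Net polynomials *)


Lemma pair_eqb (A B : eqType) (u v : A * B) :
  (u == v) = (u.1 == v.1) && (u.2 == v.2).
Proof. by case: u v => a b [c d]; rewrite xpair_eqE. Qed.

Ltac pair_lia :=
  intros; repeat match goal with u : (int * int)%type |- _ => destruct u end;
  repeat match goal with H : is_true _ |- _ => revert H end;
  rewrite ?pair_eqb /=; lia.

(** * Abscissae along an additive map from Z^2 to the curve with trivial kernel *)

Section PointsOfRankTwo.
Variables (F : fieldType) (E : weierstrass F).
Variable f : int * int -> ec_point F.
Hypothesis fD : forall u v, f (u + v) = add_point E (f u) (f v).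
Hypothesis f_inj0 : forall u, f u = Infinity -> u = 0.
Hypothesis f_curve : forall u, on_curve E (f u).
Implicit Types u v : int * int.

Definition px u : F := if f u is Affine x _ then x else 0.
Definition py u : F := if f u is Affine _ y then y else 0.

(** Yields [f 0 = Infinity] without cancellation in the group: if doubling keeps the abscissa, the
    formula returns the ordinate of the opposite point, so the point is its own opposite and its
    double lies at infinity. *)
Lemma add_point_idem (Q : ec_point F) : add_point E Q Q = Q -> Q = Infinity.
Proof.
case: Q => [//|x y] /=; rewrite eqxx /=; case: eqP => // h.
move=> [-> hy]; case: h; move: hy; set l := _ / _ => hy.
apply/eqP; rewrite -addrA -(addrA y) addr_eq0; apply/eqP.
by rewrite -{1}hy subrr mulr0; ring.
Qed.

Lemma f_zero : f 0 = Infinity.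
Proof. by apply: add_point_idem; rewrite -fD addr0. Qed.

Lemma f_affine u : u != 0 -> f u = Affine (px u) (py u).
Proof.
rewrite /px /py; case e : (f u) => [|x y] //.
by rewrite (f_inj0 e) eqxx.
Qed.

Lemma px_curve u : u != 0 -> on_curve E (Affine (px u) (py u)).
Proof. by move=> u0; rewrite -f_affine. Qed.

Lemma fN u : u != 0 -> px (- u) = px u /\ py (- u) = opp_y E (px u) (py u).
Proof.
move=> u0; have nu0 : - u != 0 by rewrite oppr_eq0.
have := fD (- u) u; rewrite addNr f_zero !f_affine //=.
case: eqP => //= ->; case: eqP => // h _; split=> //.
rewrite /opp_y; apply/eqP; rewrite -subr_eq0; apply/eqP; rewrite -[RHS]h; ring.
Qed.

Lemma curve_same_x x y y' : on_curve E (Affine x y) -> on_curve E (Affine x y') ->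
  y' = y \/ y' = opp_y E x y.
Proof.
move=> /= h h'; have : (y' - y) * (y' - opp_y E x y) = 0.
  move: h' => /eqP; rewrite -h -subr_eq0 => /eqP h'.
  by rewrite -[RHS]h' /opp_y; ring.
by move=> /eqP; rewrite mulf_eq0 !subr_eq0 => /orP[] /eqP; [left|right].
Qed.

Lemma px_inj u v : u != 0 -> v != 0 -> u != v -> u != - v -> px v - px u != 0.
Proof.
move=> u0 v0 uv uNv; rewrite subr_eq0; apply/eqP => e.
have [vx vy] := fN v0; have nv0 : - v != 0 by rewrite oppr_eq0.
have cu := px_curve u0; rewrite -e in cu.
have e0 w : f u = f w -> u = w.
  move=> euw; apply/eqP; rewrite -subr_eq0; apply/eqP/f_inj0.
  by rewrite fD euw -fD subrr f_zero.
case: (curve_same_x (px_curve v0) cu) => h.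
  by move/eqP: uv; apply; apply: e0; rewrite !f_affine // e h.
by move/eqP: uNv; apply; apply: e0; rewrite !f_affine // vx vy h e.
Qed.

Lemma pxD u v : u != 0 -> v != 0 -> u != v -> u != - v ->
  px (u + v) = chord_x E (px u) (py u) (px v) (py v).
Proof.
move=> u0 v0 uv uNv; have := px_inj u0 v0 uv uNv; rewrite subr_eq0 eq_sym.
move=> /negPf h; rewrite /px fD !f_affine //= h /=.
by rewrite /chord_x /third_x.
Qed.

Lemma pxB u v : u != 0 -> v != 0 -> u != v -> u != - v ->
  px (v - u) = chord_x E (px u) (opp_y E (px u) (py u)) (px v) (py v).
Proof.
move=> u0 v0 uv uNv; have [<- <-] := fN u0.
rewrite addrC pxD ?oppr_eq0 //; first by rewrite eqr_oppLR.
by rewrite eqr_opp.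
Qed.

Lemma double_neq0 u : u != 0 -> u + u != 0.
Proof.
pair_lia.
Qed.

Lemma psi2_neq0 u : u != 0 -> psi2 E (px u) (py u) != 0.
Proof.
move=> u0; apply/eqP => h; have := double_neq0 u0.
rewrite (f_inj0 (u := u + u)) ?eqxx // fD f_affine //= eqxx /=.
case: eqP => // -[]; rewrite -[RHS]h /psi2; ring.
Qed.

Lemma px_double u : u != 0 -> px (u + u) = double_x E (px u) (py u).
Proof.
move=> u0; rewrite {1}/px fD f_affine //= eqxx /=.
case: eqP => [h|_]; last by rewrite /double_x /third_x.
by case/eqP: (psi2_neq0 u0); rewrite -[RHS]h /psi2; ring.
Qed.

(** * Nonvanishing, addition formula and duplication formula for the net *)

Section Net.
Variable W : int * int -> F.
Let e1 : int * int := (1, 0).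
Let e2 : int * int := (0, 1).
Hypothesis netW : is_net_polynomials E (f e1) (f e2) W.

Let W0 : W 0 = 0. Proof.
by move: netW; rewrite !f_affine // => -[_ []]. Qed.

Let Wrec p q r s : 
       W (p + q + s) * W (p - q) * W (r + s) * W r
       + W (q + r + s) * W (q - r) * W (p + s) * W p
       + W (r + p + s) * W (r - p) * W (q + s) * W q = 0.
Proof. by move: netW; rewrite !f_affine // => -[_ [_ []]] ->. Qed.

(** The recurrence at p = q = v, r = s = 0 is W(v)^3 (W(v) + W(-v)) = 0. If W vanishes at u, the
    same relation at -u forces it to vanish there too. *)
Lemma netN u : W (- u) = - W u.
Proof.
have aux v : W v != 0 -> W (- v) = - W v.
  move=> v0; have := Wrec v v 0 0.
  rewrite !subrr ?addr0 ?sub0r ?subr0 ?add0r W0 ?mulr0 ?add0r ?mul0r ?add0r => h.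
  have : W v ^+ 3 * (W v + W (- v)) = 0 by rewrite -[RHS]h; ring.
  move/eqP; rewrite mulf_eq0 expf_eq0 /= (negPf v0) /= addrC addr_eq0.
  by move/eqP.
have [/eqP h|/aux //] := boolP (W u == 0).
have [/eqP h'|/aux] := boolP (W (- u) == 0); first by rewrite h h' oppr0.
by rewrite opprK h => /eqP; rewrite eq_sym oppr_eq0 => /eqP ->; rewrite oppr0.
Qed.

Lemma net_relation p q r :
  W (p + q) * W (p - q) * W r ^+ 2
  = W (p + r) * W (p - r) * W q ^+ 2 - W (q + r) * W (q - r) * W p ^+ 2.
Proof.
have := Wrec p q r 0; rewrite !addr0 => h.
have e : W (r - p) = - W (p - r) by rewrite -netN opprB.
apply/eqP; rewrite -subr_eq0; apply/eqP; rewrite -[RHS]h e (addrC r p); ring.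
Qed.

Let W1 : W e1 = 1.
Proof. by move: netW; rewrite !f_affine // => -[_ [_ [_ [[]]]]]. Qed.
Let W2 : W e2 = 1.
Proof. by move: netW; rewrite !f_affine // => -[_ [_ [_ [[] _ []]]]]. Qed.
Let W12 : W (1, 1) = 1.
Proof. by move: netW; rewrite !f_affine // => -[_ [_ [_ [[] _ [] _]]]]. Qed.
Let W20 : W (2, 0) = psi2 E (px e1) (py e1).
Proof. by move: netW; rewrite !f_affine // => -[_ [_ [_ [_ [-> _]]]]]. Qed.
Let W02 : W (0, 2) = psi2 E (px e2) (py e2).
Proof. by move: netW; rewrite !f_affine // => -[_ [_ [_ [_ [_ [-> _]]]]]]. Qed.
Let W21 : W (2, 1) = px e1 - px (e1 + e2).
Proof.
move: netW; rewrite pxD // !f_affine // => -[_ [_ [_ [_ [_ [_ [-> _]]]]]]].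
by rewrite /chord_x /third_x; ring.
Qed.
Let W12' : W (1, 2) = px e2 - px (e1 + e2).
Proof.
move: netW; rewrite pxD // !f_affine // => -[_ [_ [_ [_ [_ [_ [_ ->]]]]]]].
by rewrite /chord_x /third_x; ring.
Qed.

Let W1m1 : W (1, -1) = px e2 - px e1.
Proof.
have := net_relation e1 e2 (1, 1).
rewrite -[e1 + e2]/(1, 1) -[e1 + (1, 1)]/(2, 1) -[e2 + (1,1)]/(1, 2).
rewrite -[e1 - e2]/(1, -1) -[e1 - (1, 1)]/(- e2) -[e2 - (1,1)]/(- e1).
by rewrite !netN W1 W2 W12 W21 W12' => h; move: h; rewrite !expr1n !mulr1 mul1r !mulrN1 => ->; ring.
Qed.

(* [good v]: the value at v of the addition formula with base point e1, which
   by [net_relation] controls all differences of abscissae. *)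
Let good v := W v != 0 /\
  W (v + e1) * W (v - e1) = W v ^+ 2 * (px e1 - px v).

Let good_diff u v : good u -> good v ->
  W (u + v) * W (u - v) = W u ^+ 2 * W v ^+ 2 * (px v - px u).
Proof.
move=> [_ hu] [_ hv]; have := net_relation u v e1; rewrite W1 expr1n mulr1 => ->.
by rewrite hu hv; ring.
Qed.

Let good_of_diff u v : W v != 0 -> good u -> W u != 0 ->
  W (v + u) * W (v - u) = W v ^+ 2 * W u ^+ 2 * (px u - px v) -> good v.
Proof.
move=> v0 [_ hu] u0 h; split=> //.
have := net_relation v u e1; rewrite W1 expr1n mulr1 h hu => {}h.
apply: (mulIf (expf_neq0 2 u0)); move/eqP: h; rewrite eq_sym subr_eq => /eqP ->.
ring.
Qed.

Let goodN v : v != 0 -> good v -> good (- v).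
Proof.
move=> v0 [n h]; split; first by rewrite netN oppr_eq0.
have [-> _] := fN v0; rewrite (netN v) sqrrN -h.
have -> : - v + e1 = - (v - e1) by rewrite opprB addrC.
by rewrite -(opprD v) (netN (v - e1)) (netN (v + e1)) mulrNN mulrC.
Qed.

(** One step from v - e, v to v + e. [good_diff] for the pair v, e shows W(v + e) nonzero. The
    product W(v + 2e) W(v) is then obtained by comparing the pairs (v, 2e) and (v - e, e), whose
    formulas share W(v - 2e), and by [chord_x_step]. Only the square of W(2e) enters, so the step
    works alike for e and -e. *)
Let good_step e v : good e -> good (e + e) -> good v -> good (v - e) ->
    e != 0 -> v != 0 -> v != e -> v != - e -> v != e + e -> v != - (e + e) ->
    W (e + e) ^+ 2 = W e ^+ 8 * psi2 E (px e) (py e) ^+ 2 ->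
  good (v + e).
Proof.
move=> ge gee gv gm e0 v0 ve vNe vee vNee We2.
have [we _] := ge; have [wv _] := gv; have [wm _] := gm; have [wee _] := gee.
have ev : e != v by rewrite eq_sym.
have eNv : e != - v by rewrite -eqr_oppLR eq_sym.
have m0 : v - e != 0 by rewrite subr_eq0.
have hv := good_diff gv ge.
have wp : W (v + e) != 0.
  apply/negP => /eqP h; move: hv; rewrite h mul0r => /eqP.
  rewrite eq_sym !mulf_eq0 ?expf_eq0 /= (negPf we) (negPf wv) /=.
  by apply/negP/px_inj.
have hm := good_diff gm ge; have hvee := good_diff gv gee.
rewrite subrK -addrA -opprD in hm.
apply: (good_of_diff wp ge) => //; rewrite addrK -addrA.
have nm : px e - px (v - e) != 0.
  apply: px_inj => //; first by rewrite subr_eq.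
  by rewrite subr_eq addNr.
have npv : px e - px v != 0 by apply: px_inj.
have := @chord_x_step F E (px e) (py e) (px v) (py v).
rewrite -pxB // -pxD // -px_double // (addrC e v).
move=> /(_ _ (psi2_neq0 e0) (px_curve e0) (px_curve v0)).
have nvp : px v - px e != 0 by apply: px_inj.
move=> /(_ nvp) key.
(* By [hm] this factor is W(v)^2 W(v - 2e); written this way it is visibly nonzero. *)
apply: (mulIf (_ : W (v - e) ^+ 2 * W e ^+ 2 * (px e - px (v - e)) * W v != 0)).
  by rewrite !mulf_neq0 // expf_neq0.
have -> : W (v + (e + e)) * W v * (W (v - e) ^+ 2 * W e ^+ 2 * (px e - px (v - e)) * W v)
   = (W (v + (e + e)) * W (v - (e + e))) * W v ^+ 3.
  by rewrite -hm; ring.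
rewrite hvee We2.
transitivity ((W (v + e) * W (v - e)) ^+ 2 * W e ^+ 4 * W v * ((px e - px (v + e)) * (px e - px (v - e)))); last first.
  by ring.
rewrite hv.
transitivity (W v ^+ 5 * W e ^+ 8 * ((px e - px (v + e)) * (px e - px (v - e)) * (px e - px v) ^+ 2)); last by ring.
by rewrite key; ring.
Qed.

(** The functional [pr], in practice a coordinate, kills e but not v; this keeps the line through v
    in direction e away from 0, e, -e, 2e and -2e, the vectors excluded in [good_step]. *)
Let good_line (pr : {additive (int * int)%type -> int}) e v :
    good e -> good (e + e) -> W (e + e) ^+ 2 = W e ^+ 8 * psi2 E (px e) (py e) ^+ 2 ->
    e != 0 -> pr e = 0 -> pr v != 0 -> good v -> good (v + e) ->
  forall n, good (v + e *+ n).
Proof.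
move=> ge gee We2 e0 pe pv gv gve n.
suff: good (v + e *+ n) /\ good (v + e *+ n.+1) by case.
elim: n => [|n [IH1 IH2]]; first by rewrite mulr0n addr0 mulr1n.
split=> //; rewrite (mulrSr e n.+1) addrA.
have prv : pr (v + e *+ n.+1) != 0 by rewrite raddfD raddfMn /= pe mul0rn addr0.
have ne u : pr u = 0 -> v + e *+ n.+1 != u.
  by move=> pu; apply: contraNneq prv => ->; rewrite pu.
apply: (good_step (e := e)) => //; try by [apply: ne; rewrite ?raddf0 ?raddfN ?raddfD /= ?pe ?oppr0 ?addr0].
by rewrite mulrSr addrA addrK.
Qed.

Let x21 : px e2 - px e1 != 0. Proof. exact: px_inj. Qed.

Let good10 : good (1, 0).
Proof. by split; [rewrite W1 oner_neq0 | rewrite !subrr W0 !mulr0]. Qed.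

Let Wm11 : W (-1, 1) = px e1 - px e2.
Proof. by rewrite -[(-1, 1)]/(- (1, -1) : int * int) netN W1m1 opprB. Qed.

Let good01 : good (0, 1).
Proof.
split; first by rewrite W2 oner_neq0.
by rewrite -[(0, 1) + e1]/(1, 1) -[(0, 1) - e1]/(-1, 1) W12 W2 Wm11; ring.
Qed.

Let good11 : good (1, 1).
Proof.
split; first by rewrite W12 oner_neq0.
by rewrite -[(1, 1) + e1]/(2, 1) -[(1, 1) - e1]/(0, 1) W12 W2 W21; ring.
Qed.

Let px1m1 : px (1, -1) = px (e2 - e1).
Proof. by have [] := @fN (e2 - e1) isT. Qed.

(** Seen from (1, 1), the sum and the difference are (2, 0) and -(0, 2), where W is prescribed by
    [psi2]; [chord_x_diff] is the matching identity. *)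
Let good1m1 : good (1, -1).
Proof.
apply: (good_of_diff _ good11); rewrite ?W12 ?oner_neq0 // ?W1m1 //.
rewrite -[(1, -1) + (1, 1)]/(2, 0) -[(1, -1) - (1, 1)]/(- (0, 2) : int * int).
rewrite netN W20 W02 px1m1 -[(1, 1)]/(e1 + e2) pxD // pxB //.
by rewrite mulrN -chord_x_diff // expr1n mulr1.
Qed.

Let goodm11 : good (-1, 1).
Proof. exact: goodN good1m1. Qed.

Let W2m1 : W (2, -1) = - ((px e2 - px e1) ^+ 2 * (px e1 - px (e2 - e1))).
Proof.
have [_] := good1m1; rewrite px1m1 -[(1, -1) + e1]/(2, -1).
by rewrite -[(1, -1) - e1]/(- e2) netN W2 W1m1 mulrN1 => <-; rewrite opprK.
Qed.

(** Seen from (0, 1), the neighbours are (2, 1), which is prescribed, and (2, -1), known from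
    [good1m1]; [chord_x_step] evaluates their product. *)
Let good20 : good (2, 0).
Proof.
have W20_neq0 : W (2, 0) != 0 by rewrite W20 psi2_neq0.
apply: (good_of_diff W20_neq0 good01); first by rewrite W2 oner_neq0.
rewrite -[(2, 0) + (0, 1)]/(2, 1) -[(2, 0) - (0, 1)]/(2, -1) W21 W2m1 W2.
rewrite W20 -[(2, 0)]/(e1 + e1) px_double // -[(0, 1)]/e2.
have := chord_x_step x21 (@psi2_neq0 e1 isT) (@px_curve e1 isT) (@px_curve e2 isT).
rewrite -pxD // -pxB // => h; rewrite expr1n mulr1.
apply: oppr_inj; rewrite -[RHS]mulrN opprB -h; ring.
Qed.

Let good02 : good (0, 2).
Proof.
have W02_neq0 : W (0, 2) != 0 by rewrite W02 psi2_neq0.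
apply: (good_of_diff W02_neq0 good10); first by rewrite W1 oner_neq0.
have Wm12 : W (-1, 2) = - ((px e1 - px e2) ^+ 2 * (px e2 - px (e2 - e1))).
  have := good_diff goodm11 good01; rewrite -[(-1, 1) + (0, 1)]/(-1, 2).
  rewrite -[(-1, 1) - (0, 1)]/(- e1) netN W1 W2 Wm11.
  by rewrite expr1n mulr1 mulrN1 -[(-1, 1)]/(e2 - e1) => <-; rewrite opprK.
rewrite -[(0, 2) + (1, 0)]/(1, 2) -[(0, 2) - (1, 0)]/(-1, 2) W12' Wm12 W1.
rewrite W02 -[(0, 2)]/(e2 + e2) px_double // -[(1, 0)]/e1.
have x12 : px e1 - px e2 != 0 by apply: px_inj.
have := chord_x_step x12 (@psi2_neq0 e2 isT) (@px_curve e2 isT) (@px_curve e1 isT).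
rewrite -pxD // -pxB // -[e1 - e2]/(1, -1) px1m1 (addrC e2) => h.
rewrite expr1n mulr1; apply: oppr_inj; rewrite -[RHS]mulrN opprB -h; ring.
Qed.

Let We2 (e : int * int) : e = e1 \/ e = e2 ->
  W (e + e) ^+ 2 = W e ^+ 8 * psi2 E (px e) (py e) ^+ 2.
Proof.
case=> ->; first by rewrite -[e1 + e1]/(2, 0) W20 W1 expr1n mul1r.
by rewrite -[e2 + e2]/(0, 2) W02 W2 expr1n mul1r.
Qed.

Let WNe2 (e : int * int) : e = e1 \/ e = e2 ->
  W (- e - e) ^+ 2 = W (- e) ^+ 8 * psi2 E (px (- e)) (py (- e)) ^+ 2.
Proof.
move=> he; have e0 : e != 0 by case: he => ->.
have [-> ->] := fN e0; rewrite -opprD !netN !sqrrN (We2 he) /psi2 /opp_y; ring.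
Qed.

Let mul10 n : e1 *+ n = (n%:Z, 0).
Proof. by elim: n => // n IH; rewrite mulrS IH /=; congr pair => /=; lia. Qed.
Let mul01 n : e2 *+ n = (0, n%:Z).
Proof. by elim: n => // n IH; rewrite mulrS IH /=; congr pair => /=; lia. Qed.

Let good_row (b : int) : b != 0 -> good (0, b) -> good (1, b) -> forall a, good (a, b).
Proof.
move=> b0 g0 g1 [n|n].
  have -> : (Posz n, b) = (0, b) + e1 *+ n by rewrite mul10; congr pair => /=; lia.
  apply: (good_line (pr := snd)) => //; first by apply: We2; left.
  by have -> : (0, b) + e1 = (1, b) by congr pair => /=; lia.
have -> : (Negz n, b) = (1, b) + (- e1) *+ n.+2.
  rewrite mulNrn mul10; congr pair => /=; lia.
apply: (good_line (pr := snd)) => //; first exact: goodN good10.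
- by rewrite -opprD; exact: goodN good20.
- by apply: WNe2; left.
- by have -> : (1, b) - e1 = (0, b) by congr pair => /=; lia.
Qed.

(** Row 0 cannot be swept horizontally, as the second coordinate vanishes on it; it is reached by
    descending each column from rows 2 and 1. *)
Let good_col (a : int) : a != 0 -> good (a, 1) -> good (a, 2) ->
  forall n : nat, good (a, n%:Z).
Proof.
move=> a0 g1 g2 [|n].
  have -> : (a, Posz 0) = (a, 2) + (- e2) *+ 2.
    by rewrite mulNrn mul01; congr pair => /=; lia.
  apply: (good_line (pr := fst)) => //; first exact: goodN good01.
  - by rewrite -opprD; exact: goodN good02.
  - by apply: WNe2; right.
  - have -> : (a, 2) - e2 = (a, 1) by congr pair => /=; lia.
    by [].
have -> : (a, Posz n.+1) = (a, 1) + e2 *+ n by rewrite mul01; congr pair => /=; lia.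
apply: (good_line (pr := fst)) => //; first by apply: We2; right.
have -> : (a, 1) + e2 = (a, 2) by congr pair => /=; lia.
by [].
Qed.

(** Rows 1 and 2 seed every column with a nonzero; column 0 is entered horizontally from columns 2
    and 1, and the lower half-plane follows by oddness. *)
Let good_all v : v != 0 -> good v.
Proof.
have row1 a : good (a, 1) by apply: good_row.
have good12 : good (1, 2).
  have -> : (1, 2) = (1, 0) + e2 *+ 2 by rewrite mul01.
  by apply: (good_line (pr := fst)) => //; apply: We2; right.
have row2 a : good (a, 2) by apply: good_row.
have up a (n : nat) : (a, n%:Z) != 0 -> good (a, n%:Z).
  move=> an0; have [a0|/good_col h] := eqVneq a 0; last by apply: h.
  have n0 : n%:Z != 0 by move: an0; rewrite a0 pair_eqb.
  have -> : (a, n%:Z) = (2, n%:Z) + (- e1) *+ 2.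
    by rewrite a0 mulNrn mul10; congr pair => /=; lia.
  apply: (good_line (pr := snd)) => //; first exact: goodN good10.
  - by rewrite -opprD; exact: goodN good20.
  - by apply: WNe2; left.
  - exact: good_col.
  - have -> : (2, n%:Z) - e1 = (1, n%:Z) by congr pair => /=; lia.
    exact: good_col.
case: v => a [n|n]; first exact: up.
have -> : (a, Negz n) = - (- a, n.+1%:Z) by rewrite /=; congr pair => /=; lia.
by rewrite oppr_eq0 => h; apply: goodN => //; apply: up.
Qed.

Lemma net_neq0 v : v != 0 -> W v != 0.
Proof. by case/good_all. Qed.

Lemma net_x_diff u v : u != 0 -> v != 0 ->
  W (u + v) * W (u - v) = W u ^+ 2 * W v ^+ 2 * (px v - px u).
Proof. by move=> /good_all gu /good_all; apply: good_diff. Qed.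

(** Since 2u and 2v are the sum and the difference of u + v and u - v, the addition formula gives
    W(2u) W(2v), and [chord_x_diff] splits it into a factor for u and one for v. So the formula
    passes from one v to any u other than v and -v; it is prescribed at e1 and e2. *)
Lemma net_double u : u != 0 -> W (u + u) = W u ^+ 4 * psi2 E (px u) (py u).
Proof.
move=> u0.
have key v : v != 0 -> u != v -> u != - v -> W (v + v) = W v ^+ 4 * psi2 E (px v) (py v) ->
    W (u + u) = W u ^+ 4 * psi2 E (px u) (py u).
  move=> v0 uv uNv Wv.
  have p0 : u + v != 0 by rewrite addr_eq0.
  have m0 : u - v != 0 by rewrite subr_eq0.
  have es : u + v + (u - v) = u + u by rewrite addrCA addrK.
  have ed : u + v - (u - v) = v + v by rewrite opprB addrC addrA subrK.
  have := net_x_diff p0 m0; rewrite es ed => h.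
  have nW := net_neq0 v0.
  have vv : W (v + v) != 0.
    by rewrite Wv mulf_neq0 ?psi2_neq0 // expf_neq0.
  apply: (mulIf vv); rewrite h -exprMn (net_x_diff u0 v0) Wv.
  have vu : v != u by rewrite eq_sym.
  have vNu : v != - u by rewrite -eqr_oppLR eq_sym.
  have := chord_x_diff E (py v) (py u) (px_inj v0 u0 vu vNu).
  rewrite -pxD // -pxB // (addrC v) => hd.
  rewrite -[psi2 _ _ _]opprK.
  transitivity (- (W u ^+ 4 * W v ^+ 4 * ((px u - px v) ^+ 2 * (px (u + v) - px (u - v))))); first ring.
  by rewrite hd; ring.
have [/orP h|] := boolP ((u == e1) || (u == - e1)).
  apply: (key e2) => //; try by case: h => /eqP ->.
  by rewrite -[e2 + e2]/(0, 2) W02 W2 expr1n mul1r.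
rewrite negb_or => /andP[h1 h2]; apply: (key e1) => //.
by rewrite -[e1 + e1]/(2, 0) W20 W1 expr1n mul1r.
Qed.

End Net.
End PointsOfRankTwo.

(** * Reduction modulo a valuation *)


Section ValuationRing.
Variables (F : fieldType) (V : set F).
Hypotheses (V1 : V 1) (VB : forall x y, V x -> V y -> V (x - y))
  (VM : forall x y, V x -> V y -> V (x * y)) (VorV : forall x, V x \/ V x^-1).
Implicit Types x y z : F.

Definition vunit x : Prop := [/\ x != 0, V x & V x^-1].
Definition vmax x : Prop := V x /\ ~ vunit x.

Lemma val0 : V 0. Proof. by rewrite -(subrr 1); apply: VB. Qed.
Lemma valN x : V x -> V (- x).
Proof. by rewrite -sub0r; apply: VB; apply: val0. Qed.
Lemma valD x y : V x -> V y -> V (x + y).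
Proof. by rewrite -{2}(opprK y) => vx /valN; apply: VB. Qed.
Lemma valX x n : V x -> V (x ^+ n).
Proof. by move=> vx; elim: n => // n IH; rewrite exprS; apply: VM. Qed.
Lemma val_nat n : V n%:R.
Proof. by elim: n => [|n IH]; [apply: val0 | rewrite mulrS; apply: valD]. Qed.
Lemma valMn x n : V x -> V (x *+ n).
Proof. by move=> vx; rewrite -mulr_natr; apply: VM => //; apply: val_nat. Qed.

Lemma vunit1 : vunit 1. Proof. by split; rewrite ?invr1 ?oner_neq0. Qed.
Lemma vunitM x y : vunit x -> vunit y -> vunit (x * y).
Proof.
move=> [x0 vx vx'] [y0 vy vy']; split; rewrite ?mulf_neq0 ?invfM //; exact: VM.
Qed.
Lemma vunitV x : vunit x -> vunit x^-1.
Proof. by move=> [x0 vx vx']; split; rewrite ?invr_eq0 ?invrK. Qed.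
Lemma vunitX x n : vunit x -> vunit (x ^+ n).
Proof.
by move=> ux; elim: n => [|n IH]; [apply: vunit1 | rewrite exprS; apply: vunitM].
Qed.
Lemma vunitMl x y : V x -> V y -> vunit (x * y) -> vunit x.
Proof.
move=> vx vy [xy0 vxy vxy']; move: xy0; rewrite mulf_eq0 negb_or => /andP[x0 y0].
split=> //; have -> : x^-1 = y * (x * y)^-1 by field; rewrite ?x0 ?y0.
exact: VM.
Qed.
Lemma vunitN x : vunit x -> vunit (- x).
Proof. by move=> [x0 vx vx']; split; rewrite ?oppr_eq0 ?invrN //; apply: valN. Qed.

Lemma val_cases x : V x -> vunit x \/ vmax x.
Proof. by move=> vx; have [u|nu] := pselect (vunit x); [left | right]. Qed.

Lemma vmaxV x : ~ V x -> vmax x^-1.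
Proof.
move=> nx; have [//|vx] := VorV x; split=> // -[_ _]; by rewrite invrK.
Qed.

Lemma vmaxM x y : vmax x -> V y -> vmax (x * y).
Proof.
by move=> [vx nx] vy; split; [apply: VM | move=> /(vunitMl vx vy)].
Qed.
Lemma vmaxMr x y : V x -> vmax y -> vmax (x * y).
Proof. by move=> vx my; rewrite mulrC; apply: vmaxM. Qed.
Lemma vmaxN x : vmax x -> vmax (- x).
Proof. by move=> mx; rewrite -mulN1r; apply: vmaxMr => //; apply: valN. Qed.

Lemma vmaxD x y : vmax x -> vmax y -> vmax (x + y).
Proof.
move=> [vx nx] [vy ny]; split; first exact: valD.
have aux a b : V a -> V b -> b != 0 -> V (a / b) -> vunit (a + b) -> vunit b.
  move=> va vb b0 vab; have -> : a + b = b * (a / b + 1) by field.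
  by apply: vunitMl => //; apply: valD.
have [->|x0] := eqVneq x 0; first by rewrite add0r.
have [->|y0] := eqVneq y 0; first by rewrite addr0.
have [h|] := VorV (x / y); first by move/(aux x y vx vy y0 h).
by rewrite invf_div addrC => h; move/(aux y x vy vx x0 h).
Qed.
Lemma vmaxB x y : vmax x -> vmax y -> vmax (x - y).
Proof. by move=> mx /vmaxN; apply: vmaxD. Qed.

Lemma vmax_prime x y : V x -> V y -> vmax (x * y) -> vmax x \/ vmax y.
Proof.
move=> vx vy [_ nxy]; have [ux|] := val_cases vx; last by left.
have [uy|] := val_cases vy; last by right.
by case: nxy; apply: vunitM.
Qed.
Lemma vmax_unit x : vmax x -> vunit x -> False. Proof. by case. Qed.
Lemma vmax_sqr x : V x -> vmax (x ^+ 2) -> vmax x.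
Proof. by move=> vx; rewrite expr2 => /(vmax_prime vx vx)[]. Qed.

(** If x were outside V, its inverse would lie in V, and so would x = x^2 x^-1. *)
Lemma val_sqr x : V (x ^+ 2) -> V x.
Proof.
move=> vx2; have [//|] := pselect (V x) => nx.
have [vx' nu] := vmaxV nx; have x0 : x != 0.
  by apply/eqP => x0; apply: nx; rewrite x0; apply: val0.
by have := VM vx2 vx'; rewrite expr2 mulfK.
Qed.

Lemma vunit_sqr x : vunit (x ^+ 2) -> vunit x.
Proof.
by move=> [x0]; rewrite -exprVn => /val_sqr h /val_sqr h'; split=> //; move: x0; rewrite expf_eq0.
Qed.

(* z generates the inverse of the fractional ideal (1, x). *)
Definition vden z x : Prop :=
  [/\ z != 0, V z, V (z * x) & vunit z \/ vunit (z * x)].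

(** Modulo the maximal ideal (x1, z1) is proportional to the primitive vector (x2, z2), so a binary
    quadratic form vanishing at the second vanishes at the first. Multiplying by the square of a
    unit coordinate of the second makes this a polynomial identity. *)
Lemma quadratic_form_vmax a b c x1 z1 x2 z2 :
    [/\ V a, V b & V c] -> [/\ V x1, V z1, V x2 & V z2] ->
    vmax (z1 * x2 - z2 * x1) -> vunit z2 \/ vunit x2 ->
    vmax (a * x2 ^+ 2 + b * x2 * z2 + c * z2 ^+ 2) ->
  vmax (a * x1 ^+ 2 + b * x1 * z1 + c * z1 ^+ 2).
Proof.
move=> [va vb vc] [vx1 vz1 vx2 vz2] md u2 mq.
set q := (X in vmax X).
have key t : vunit t -> vmax (t ^+ 2 * q) -> vmax q.
  move=> /(vunitX 2) ut; rewrite -{2}(mulKf (_ : t ^+ 2 != 0) q); last by case: ut.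
  by apply: vmaxMr; case: ut.
case: u2 => u; apply: (key _ u).
  have -> : z2 ^+ 2 * q = z1 ^+ 2 * (a * x2 ^+ 2 + b * x2 * z2 + c * z2 ^+ 2)
      - (z1 * x2 - z2 * x1) * (a * (z1 * x2 + z2 * x1) + b * (z1 * z2)).
    by rewrite /q; ring.
  apply: vmaxB; first by apply: vmaxMr => //; apply: valX.
  by apply: vmaxM => //; do ?[apply: valD | apply: VM].
have -> : x2 ^+ 2 * q = x1 ^+ 2 * (a * x2 ^+ 2 + b * x2 * z2 + c * z2 ^+ 2)
      + (z1 * x2 - z2 * x1) * (b * (x1 * x2) + c * (z1 * x2 + z2 * x1)).
  by rewrite /q; ring.
apply: vmaxD; first by apply: vmaxMr => //; apply: valX.
by apply: vmaxM => //; do ?[apply: valD | apply: VM].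
Qed.

(** * Weierstrass equations with coefficients in the valuation ring *)

Section LocalCurve.
Variable E : weierstrass F.
Hypotheses (Va1 : V (a1 E)) (Va2 : V (a2 E)) (Va3 : V (a3 E)) (Va4 : V (a4 E))
  (Va6 : V (a6 E)).

Ltac val_tac := do ?[assumption | apply: valD | apply: valN | apply: VM
   | apply: valX | apply: valMn | apply: val_nat | apply: V1].

Let vb2 : V (b2 E). Proof. by rewrite /b2; val_tac. Qed.
Let vb4 : V (b4 E). Proof. by rewrite /b4; val_tac. Qed.
Let vb6 : V (b6 E). Proof. by rewrite /b6; val_tac. Qed.
Let vb8 : V (b8 E). Proof. by rewrite /b8; val_tac. Qed.

Definition vsmooth x y : Prop :=
  ~ [/\ V x, V y, vmax (tangent_num E x y) & vmax (psi2 E x y)].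

Lemma val_y x y : on_curve E (Affine x y) -> V x -> V y.
Proof.
move=> /= h vx; have [//|] := pselect (V y) => ny.
have y0 : y != 0 by apply/eqP => y0; apply: ny; rewrite y0; apply: val0.
have my := vmaxV ny; have [vy' _] := my; case: (vmax_unit (x := 1) _ vunit1).
(* Dividing the equation by y^2 would put 1 in the maximal ideal. *)
have -> : 1 = y^-1 * (y^-1 * (x ^+ 3 + a2 E * x ^+ 2 + a4 E * x + a6 E)
                      - (a1 E * x + a3 E)) by rewrite -h; field.
by apply: vmaxM => //; val_tac.
Qed.

(** If z is not a unit, the leading term (z x)^4 of the second form is a unit. Otherwise x and y are
    integral; the first form is the square of [psi2], and once that vanishes the second reduces to
    the square of [tangent_num], so both partial derivatives vanish and the reduction is
    singular. *)
Lemma smooth_unimodular x y z : on_curve E (Affine x y) -> vsmooth x y ->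
  vden z x -> vmax (z ^+ 4 * sum_form E x x) -> vmax (z ^+ 4 * prod_form E x x) ->
  False.
Proof.
move=> h ns [z0 vz vzx uz] ms mp.
have [u|mz] := val_cases vz; last first.
  case: uz => [/(vmax_unit mz) //|uzx].
  have : vmax ((z * x) ^+ 4).
    have -> : (z * x) ^+ 4 = z ^+ 4 * prod_form E x x
      + z * (b4 E * (z * x) ^+ 2 * z + 2 * b6 E * (z * x) * z ^+ 2 + b8 E * z ^+ 3).
      by rewrite /prod_form; ring.
    by apply: vmaxD => //; apply: vmaxM => //; val_tac.
  by move/vmax_unit; apply; apply: vunitX.
have vx : V x.
  by rewrite -(mulKf z0 x); apply: VM => //; case: u.
have vy := val_y h vx.
have red t : vmax (z ^+ 4 * t) -> vmax t.
  have u4 := vunitX 4 u; rewrite -{2}(mulKf (_ : z ^+ 4 != 0) t); last by case: u4.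
  by apply: vmaxMr; case: u4.
apply: ns; have vp : V (psi2 E x y) by rewrite /psi2; val_tac.
have vn : V (tangent_num E x y) by rewrite /tangent_num; val_tac.
have mpsi : vmax (psi2 E x y).
  by apply: vmax_sqr => //; rewrite -sum_form_diag //; apply: red.
split=> //; apply: vmax_sqr => //.
have -> : tangent_num E x y ^+ 2 = prod_form E x x
   + psi2 E x y * ((a2 E + 2 * x) * psi2 E x y - a1 E * tangent_num E x y).
  by rewrite (prod_form_diag h); ring.
by apply: vmaxD; [apply: red | apply: vmaxM => //; val_tac].
Qed.

(** Both families generate the unit ideal, so the scalar carrying one to the other is a unit. *)
Lemma unimodular_ratio I (mm bb : I -> F) c : c != 0 ->
    (forall i, V (mm i)) -> (forall i, V (bb i)) -> (forall i, c * mm i = bb i) ->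
    (exists i, vunit (mm i)) -> (exists i, vunit (bb i)) ->
  vunit c.
Proof.
move=> c0 vm vb e [i [mi0 _ ui]] [j [bj0 _ uj]]; split=> //.
  by rewrite -(mulfK mi0 c) e; apply: VM.
have mj0 : mm j != 0 by apply: contraNneq bj0 => h; rewrite -e h mulr0.
by rewrite -(mulVKf mj0 c^-1) -invfM (mulrC _ c) e; apply: VM.
Qed.

Lemma not_all_vmax (I : Type) (mm : I -> F) : (forall i, V (mm i)) ->
  ~ (forall i, vmax (mm i)) -> exists i, vunit (mm i).
Proof.
move=> vm h; apply: contrapT => hn; apply: h => i.
by have [u|//] := val_cases (vm i); case: hn; exists i.
Qed.

(** [mm] holds the coefficients of the product of the primitive linear forms zp T + zp xp and zm T +
    zm xm. [bb] holds (x2 - x1)^2, [sum_form] and [prod_form], homogenized. If all of [bb] vanished,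
    the first entry would identify the two abscissae modulo the maximal ideal, and the other two
    would contradict [smooth_unimodular]. *)
Lemma vden_add x1 y1 x2 xp xm z1 z2 zp zm :
    on_curve E (Affine x1 y1) -> vsmooth x1 y1 -> x2 - x1 != 0 ->
    (x2 - x1) ^+ 2 * (xp + xm) = sum_form E x1 x2 ->
    (x2 - x1) ^+ 2 * (xp * xm) = prod_form E x1 x2 ->
    vden z1 x1 -> vden z2 x2 -> vden zp xp -> vden zm xm ->
  vunit ((x2 - x1) ^+ 2 * z1 ^+ 2 * z2 ^+ 2 / (zp * zm)).
Proof.
move=> h1 ns n12 hs hp d1 [z20 vz2 vx2 u2] [zp0 vzp vxp up] [zm0 vzm vxm um].
have [z10 vz1 vx1 u1] := d1.
pose mm (i : 'I_3) := [:: zp * zm; (zp * xp) * zm + zp * (zm * xm);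
                          (zp * xp) * (zm * xm)]`_i.
pose X1 := z1 * x1; pose X2 := z2 * x2.
pose bb (i : 'I_3) := [:: (z1 * X2 - z2 * X1) ^+ 2;
   2 * X1 * z1 * X2 ^+ 2 + (2 * X1 ^+ 2 + b2 E * X1 * z1 + b4 E * z1 ^+ 2) * X2 * z2
     + (b4 E * X1 * z1 + b6 E * z1 ^+ 2) * z2 ^+ 2;
   X1 ^+ 2 * X2 ^+ 2 + (- (b4 E * X1 * z1) - b6 E * z1 ^+ 2) * X2 * z2
     + (- (b6 E * X1 * z1) - b8 E * z1 ^+ 2) * z2 ^+ 2]`_i.
have vd : V (z1 * X2 - z2 * X1) by apply: VB; apply: VM.
apply: (unimodular_ratio (mm := mm) (bb := bb)).
- by rewrite !(mulf_neq0, invr_eq0, expf_neq0) // invr_eq0 mulf_neq0.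
- by case=> -[|[|[|]]] //= i; rewrite /mm /=; val_tac.
- by case=> -[|[|[|]]] //= i; rewrite /bb /=; val_tac.
- case=> -[|[|[|]]] //= i; rewrite /bb /mm /= /X1 /X2.
  + by field; rewrite ?zp0 ?zm0.
  + transitivity (z1 ^+ 2 * z2 ^+ 2 * ((x2 - x1) ^+ 2 * (xp + xm))).
      by field; rewrite ?zp0 ?zm0.
    by rewrite hs /sum_form; ring.
  + transitivity (z1 ^+ 2 * z2 ^+ 2 * ((x2 - x1) ^+ 2 * (xp * xm))).
      by field; rewrite ?zp0 ?zm0.
    by rewrite hp /prod_form; ring.
- apply: not_all_vmax => [|mmax].
    by case=> -[|[|[|]]] //= i; rewrite /mm /=; val_tac.
  have := mmax (@Ordinal 3 0 isT); have := mmax (@Ordinal 3 1 isT).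
  have := mmax (@Ordinal 3 2 isT); rewrite /mm /= => m2 m1 m0.
  (* Gauss's lemma for linear forms: if a vanishes, a' is a unit, the middle coefficient kills b,
     and then a' b' is a unit. *)
  have fin a b a' b' : V a -> V b -> vmax a -> vunit a \/ vunit a' -> vunit b \/ vunit b' ->
      V a' -> V b' -> vmax (a' * b + a * b') -> vmax (a' * b') -> False.
    move=> va vb ma [/(vmax_unit ma) //|ua'] ub va' vb' ms mp.
    have mb : vmax b.
      case: (vmax_prime va' vb) => [|/vmax_unit /(_ ua') //|//].
      by rewrite -(addrK (a * b') (a' * b)); apply: vmaxB => //; apply: vmaxM.
    case: ub => [/(vmax_unit mb) //|ub'].
    by apply: (vmax_unit mp); apply: vunitM.
  case: (vmax_prime vzp vzm m0) => mz.
    exact: (fin zp zm (zp * xp) (zm * xm)).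
  apply: (fin zm zp (zm * xm) (zp * xp)) => //; last by rewrite mulrC.
  by rewrite addrC mulrC (mulrC _ zp).
- apply: not_all_vmax => [|bmax].
    by case=> -[|[|[|]]] //= i; rewrite /bb /=; val_tac.
  have := bmax (@Ordinal 3 0 isT); have := bmax (@Ordinal 3 1 isT).
  have := bmax (@Ordinal 3 2 isT); rewrite /bb /= => m2 m1 m0.
  have md := vmax_sqr vd m0.
  apply: (smooth_unimodular h1 ns d1).
    have := quadratic_form_vmax _ _ md u2 m1.
    have -> : z1 ^+ 4 * sum_form E x1 x1 = 2 * X1 * z1 * X1 ^+ 2
      + (2 * X1 ^+ 2 + b2 E * X1 * z1 + b4 E * z1 ^+ 2) * X1 * z1
      + (b4 E * X1 * z1 + b6 E * z1 ^+ 2) * z1 ^+ 2 by rewrite /sum_form /X1; ring.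
    by apply; split=> //; val_tac.
  have := quadratic_form_vmax _ _ md u2 m2.
  have -> : z1 ^+ 4 * prod_form E x1 x1 = X1 ^+ 2 * X1 ^+ 2
      + (- (b4 E * X1 * z1) - b6 E * z1 ^+ 2) * X1 * z1
      + (- (b6 E * X1 * z1) - b8 E * z1 ^+ 2) * z1 ^+ 2 by rewrite /prod_form /X1; ring.
  by apply; split=> //; val_tac.
Qed.

(** Diagonal analogue of [vden_add]: the vector (1, x(2P)) cleared by z' is compared with the two
    forms at (x, x) cleared by z^4. *)
Lemma vden_double x y x' z z' :
    on_curve E (Affine x y) -> vsmooth x y -> psi2 E x y != 0 ->
    x' * psi2 E x y ^+ 2 = prod_form E x x ->
    vden z x -> vden z' x' ->
  vunit (psi2 E x y ^+ 2 * z ^+ 4 / z').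
Proof.
move=> h ns p0 hx' d [z'0 vz' vx' u'].
have [z0 vz vx u] := d; pose X := z * x.
pose mm (i : bool) := if i then z' else z' * x'.
pose bb (i : bool) := if i then
  2 * X * z * X ^+ 2 + (2 * X ^+ 2 + b2 E * X * z + b4 E * z ^+ 2) * X * z
     + (b4 E * X * z + b6 E * z ^+ 2) * z ^+ 2 else
  X ^+ 2 * X ^+ 2 + (- (b4 E * X * z) - b6 E * z ^+ 2) * X * z
     + (- (b6 E * X * z) - b8 E * z ^+ 2) * z ^+ 2.
have vb i : V (bb i) by case: i; rewrite /bb /=; val_tac.
have bt : z ^+ 4 * sum_form E x x = bb true by rewrite /bb /X /sum_form; ring.
have bf : z ^+ 4 * prod_form E x x = bb false by rewrite /bb /X /prod_form; ring.
apply: (unimodular_ratio (mm := mm) (bb := bb)) => //.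
- by rewrite !(mulf_neq0, invr_eq0, expf_neq0).
- by case; rewrite /mm.
- case; first by rewrite -bt (sum_form_diag h) /mm divfK // mulrC.
  by rewrite -bf -hx' /mm mulrA divfK //; ring.
- by case: u' => ?; [exists true | exists false].
- apply: not_all_vmax => // bmax.
  by apply: (smooth_unimodular h ns d); rewrite ?bt ?bf.
Qed.

End LocalCurve.
End ValuationRing.

(** * Localization of the ring of integers *)


Section Integers.
Variable K : fieldExtType rat.
Notation O := (@ring_of_integers K).
Implicit Types (x y z : K).

Lemma int_integral (n : int) : O n%:~R. Proof. exact: integral_id. Qed.
Lemma nat_integral (n : nat) : O n%:R. Proof. exact: integral_nat. Qed.
Lemma integral_0 : O 0. Proof. exact: integral0. Qed.
Lemma integral_1 : O 1. Proof. exact: integral1. Qed.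
Lemma integralD x y : O x -> O y -> O (x + y). Proof. exact: integral_add. Qed.
Lemma integralB x y : O x -> O y -> O (x - y). Proof. exact: integral_sub. Qed.
Lemma integralM x y : O x -> O y -> O (x * y). Proof. exact: integral_mul. Qed.
Lemma integralN x : O x -> O (- x). Proof. exact: integral_opp. Qed.
Lemma integralX x n : O x -> O (x ^+ n).
Proof.
by move=> ox; elim: n => [|n IH]; [apply: integral_1 | rewrite exprS; apply: integralM].
Qed.
Lemma integral_sum (I : Type) (r : seq I) (P : pred I) (f : I -> K) :
  (forall i, O (f i)) -> O (\sum_(i <- r | P i) f i).
Proof. by move=> h; apply: big_ind => //; [apply: integral_0 | apply: integralD]. Qed.

Lemma intr_neq0 (n : int) : n != 0 -> n%:~R != 0 :> K.
Proof. by rewrite -(rmorph_int (in_alg K)) fmorph_eq0 intr_eq0. Qed.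

(* Over the ring of integers, c x^n + ... = 0 makes c x integral: multiply by c^(n-1). *)
Lemma integral_lead (p : {poly K}) x : (forall i, O p`_i) -> root p x ->
  O (lead_coef p * x).
Proof.
move=> op px; have [->|p0] := eqVneq p 0; first by rewrite lead_coef0 mul0r; apply: integral_0.
set c := lead_coef p; have c0 : c != 0 by rewrite lead_coef_eq0.
have sp : (1 < size p)%N.
  have [//|] := ltnP 1 (size p) => /size1_polyC e; move: px p0.
  by rewrite e rootC => /eqP ->; rewrite eqxx.
set n := (size p).-2; have spE : size p = n.+2 by rewrite /n; case: (size p) sp => [|[]].
pose q := 'X^(n.+1) + \poly_(i < n.+1) (p`_i * c ^+ (n - i)).
have sq : (size (\poly_(i < n.+1) (p`_i * c ^+ (n - i)))%R < size ('X^(n.+1) : {poly K}))%N.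
  by rewrite size_polyXn ltnS size_poly.
have mq : q \is monic by rewrite monicE /q lead_coefDl // lead_coefXn.
apply: (integral_root_monic mq).
  rewrite /root /q hornerD hornerXn horner_poly.
  have -> : (c * x) ^+ n.+1 + \sum_(i < n.+1) p`_i * c ^+ (n - i) * (c * x) ^+ i
          = c ^+ n * p.[x].
    rewrite horner_coef spE [in RHS]big_ord_recr /= mulrDr addrC mulr_sumr; congr +%R.
      apply: eq_bigr => i _; rewrite exprMn.
      have -> : c ^+ n = c ^+ (n - i) * c ^+ i by rewrite -exprD subnK // -ltnS.
      ring.
    have -> : p`_n.+1 = c by rewrite /c lead_coefE spE.
    by rewrite exprMn !exprS; ring.
  by rewrite (rootP px) mulr0.
apply/integral_poly => i; rewrite coefD coefXn coef_poly.
apply: integralD; first exact: nat_integral.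
case: ifP => _; last exact: integral_0.
by apply: integralM => //; apply: integralX; rewrite /c lead_coefE.
Qed.

(** Clear denominators in a rational relation, then divide by p while all coefficients allow it; the
    absolute value of a fixed nonzero coefficient decreases, which ends the descent. *)
Lemma int_dependence k (y : 'I_k -> K) (p : nat) : prime p -> (\dim {:K} < k)%N ->
  exists c : 'I_k -> int, (exists i, ~~ (p%:Z %| c i)%Z) /\
    \sum_(i < k) (c i)%:~R * y i = 0.
Proof.
move=> pp dk.
have [q [qs [j qj]]] : exists q : 'I_k -> rat, \sum_i q i *: y i = 0 /\ exists j, q j != 0.
  pose Y := [tuple y i | i < k].
  have /negP nf : ~~ free Y.
    apply/negP => /eqP fY; have := dimvS (subvf <<Y>>%VS).
    by rewrite fY size_tuple leqNgt dk.
  have : ~ (forall q : 'I_k -> rat, \sum_i q i *: Y`_i = 0 -> forall i, q i = 0).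
    by move/freeP.
  move=> /existsNP[q /not_implyP[qs /existsNP[j /eqP qj]]]; exists q; split; last by exists j.
  by rewrite -[RHS]qs; apply: eq_bigr => i _; rewrite -tnth_nth tnth_mktuple.
pose d := \prod_i denq (q i).
have /boolp.choice[c ce] : forall i, exists c : int, c%:~R = d%:~R * q i.
  move=> i.
  exists (\prod_(l | l != i) denq (q l) * numq (q i)).
  have -> : d = denq (q i) * \prod_(l | l != i) denq (q l) by rewrite /d (bigD1 i).
  by rewrite !intrM numqE; ring.
have d0 : d != 0 by apply/prodf_neq0 => i _; apply: denq_neq0.
have cj : c j != 0 by rewrite -(intr_eq0 rat) ce mulf_neq0 // intr_eq0.
have cs : \sum_i (c i)%:~R * y i = 0.
  transitivity (\sum_i d%:~R *: (q i *: y i)); last by rewrite -scaler_sumr qs scaler0.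
  by apply: eq_bigr => i _; rewrite scalerA -ce scaler_int mulrzl.
have [N] := ubnP `|c j|%N; elim: N => // N IH in c {ce} cj cs *.
move=> cN.
have [h|/existsNP[i /negP hi]] := pselect (forall i, (p%:Z %| c i)%Z); last first.
  by exists c; split=> //; exists i.
have /boolp.choice[b be] : forall i, exists b : int, c i = b * p%:Z.
  by move=> i; apply/dvdzP.
apply: (IH b).
- by apply: contraNneq cj => h0; rewrite be h0 mul0r.
- have p0 : (p%:Z)%:~R != 0 :> K by apply: intr_neq0; have := prime_gt0 pp; lia.
  apply: (mulfI p0); rewrite mulr0 -[RHS]cs mulr_sumr; apply: eq_bigr => i _.
  by rewrite be rmorphM /=; ring.
- move: cN cj; rewrite be abszM /=; have := prime_gt1 pp; nia.
Qed.

Lemma int_poly_root x : exists2 q : {poly int}, q != 0 & (map_poly intr q).[x] = 0.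
Proof.
pose k := (\dim {:K}).+1.
have [c [[i ci] cs]] := @int_dependence k (fun i => x ^+ i) 2 isT (ltnSn _).
pose q : {poly int} := \poly_(i < k) c (inord i).
have q0 : q != 0.
  apply/eqP => /(congr1 (fun q : {poly int} => q`_i)); rewrite coef0 coef_poly ltn_ord.
  by rewrite inord_val => e; move: ci; rewrite e dvdz0.
have qy : (map_poly intr q).[x] = 0.
  rewrite (horner_coef_wide (n := k)); last first.
    by rewrite map_polyE (leq_trans (size_Poly _)) // size_map size_poly.
  rewrite -[RHS]cs; apply: eq_bigr => j _.
  by rewrite coef_map_id0 // coef_poly ltn_ord inord_val.
by exists q.
Qed.

(** Once factors X are removed from an integer polynomial vanishing at y, its constant term is a
    nonzero integer and an integral multiple of y. *)
Lemma ideal_contains_nat (I : set K) : ideal O I -> nonzero I ->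
  exists2 n : nat, (0 < n)%N & I n%:R.
Proof.
move=> [IO [_ _ IM]] [y my y0]; have [q q0 qy] := int_poly_root y.
move: q0 qy; elim/poly_ind: q => [|q a IH]; first by rewrite eqxx.
have [->|a0 _] := eqVneq a 0.
  rewrite addr0 rmorphM /= map_polyX hornerMX mulf_eq0 polyX_eq0 orbF => q0 /eqP.
  by rewrite mulf_eq0 => /orP[/eqP|/eqP //]; apply: IH.
rewrite rmorphD rmorphM /= map_polyX map_polyC hornerD hornerMX hornerC /= => /eqP.
rewrite addrC addr_eq0 => /eqP ea.
have ma : I a%:~R.
  rewrite ea -mulNr; apply: (IM _ _ _ my); apply: integralN; apply: integral_horner (IO _ my).
  by apply/integral_poly => l; rewrite coef_map; apply: int_integral.
exists `|a|%N; first by lia.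
have -> : (`|a|%N)%:R = (sgz a)%:~R * a%:~R :> K.
  by rewrite -rmorphM /= -abszEsg.
by apply: IM => //; apply: int_integral.
Qed.


(** * The localization at a nonzero prime is a valuation ring *)

Section Prime.
Variable m : set K.
Hypothesis hm : nonzero_prime_ideal O m.

Let mO x : m x -> O x. Proof. by case: hm => -[h _] _ _ _; apply: h. Qed.
Let m0 : m 0. Proof. by case: hm => -[_ []]. Qed.
Let mD x y : m x -> m y -> m (x + y). Proof. by case: hm => -[_ []] _ h _ _ _ _; apply: h. Qed.
Let mM x y : O x -> m y -> m (x * y). Proof. by case: hm => -[_ []] _ _ h _ _ _; apply: h. Qed.
Let m1 : ~ m 1. Proof. by case: hm. Qed.
Let mP x y : O x -> O y -> m (x * y) -> m x \/ m y. Proof. by case: hm => _ _ _; apply. Qed.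

Lemma prime_contains_int : exists2 p : nat, prime p & m p%:R.
Proof.
have [hI hn _ _] := hm; have [n n0 mn] := ideal_contains_nat hI hn.
elim/ltn_ind: n n0 mn => n IH n0 mn.
have [n1|n1] := leqP n 1.
  by have e : n = 1%N by [lia]; move: mn; rewrite e.
have pn := pdiv_prime n1; have := mn.
rewrite -(divnK (pdiv_dvd n)) natrM => /mP[||h|h]; try exact: nat_integral.
  by apply: IH h; rewrite ?ltn_Pdiv ?prime_gt1 ?divn_gt0 ?pdiv_gt0 ?pdiv_leq.
by exists (pdiv n).
Qed.



Notation V := (localization O m).

Lemma prime_int_notin (p : nat) (n : int) : prime p -> m p%:R ->
  ~~ (p%:Z %| n)%Z -> ~ m n%:~R.
Proof.
move=> pp mp pn mn.
have : coprimez p n by rewrite coprimezE prime_coprime.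
move=> /coprimezP[[u v] /= e]; apply: m1.
have -> : 1 = u%:~R * p%:R + v%:~R * n%:~R :> K.
  by rewrite -[p%:R]/((p%:Z)%:~R) -!intrM -intrD e.
by apply: mD; apply: mM => //; apply: int_integral.
Qed.

Lemma loc_integral x : O x -> V x.
Proof. by exists x, 1; split; rewrite ?divr1 //; apply: integral_1. Qed.

Let notin_neq0 b : ~ m b -> b != 0.
Proof. by move=> mb; apply/eqP => b0; apply: mb; rewrite b0. Qed.
Let notinM a b : O a -> O b -> ~ m a -> ~ m b -> ~ m (a * b).
Proof. by move=> oa ob ma mb /(mP oa ob)[]. Qed.

Lemma loc1 : V 1. Proof. exact/loc_integral/integral_1. Qed.
Lemma locM x y : V x -> V y -> V (x * y).
Proof.
move=> [a [b [oa ob mb ->]]] [c [d [oc od md ->]]].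
exists (a * c), (b * d); split; rewrite ?mulf_div //; try exact: integralM.
exact: notinM.
Qed.
Lemma locB x y : V x -> V y -> V (x - y).
Proof.
move=> [a [b [oa ob mb ->]]] [c [d [oc od md ->]]].
exists (a * d - c * b), (b * d); split.
- by apply: integralB; apply: integralM.
- exact: integralM.
- exact: notinM.
- have := notin_neq0 mb; have := notin_neq0 md; move=> *; field.
  by do ?[apply/andP; split].
Qed.

(* The coefficients of a polynomial vanishing at x are peeled off from the top:
   c x^n + d x^(n-1) = (c x + d) x^(n-1) with c x integral. *)
Lemma coef_split x (q : {poly K}) : (forall i, O q`_i) -> root q x ->
  forall i, exists u v, [/\ O u, O v, O (u * x), O (v * x) & q`_i = u + v * x].
Proof.
pose S t := exists u v, [/\ O u, O v, O (u * x), O (v * x) & t = u + v * x].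
have SD a b : S a -> S b -> S (a + b).
  move=> [u [v [? ? ? ? ->]]] [u' [v' [? ? ? ? ->]]]; exists (u + u'), (v + v').
  by split; rewrite ?mulrDl; try exact: integralD; ring.
have S0 : S 0.
  by exists 0, 0; rewrite !mul0r addr0; split=> //; apply: integral_0.
have Sc c : O c -> O (c * x) -> S c.
  by move=> oc ocx; exists c, 0; rewrite mul0r addr0; split=> //; apply: integral_0.
have Scx c : O c -> O (c * x) -> S (- (c * x)).
  move=> oc ocx; exists 0, (- c); rewrite mul0r add0r !mulNr; split=> //;
  by [apply: integral_0 | apply: integralN].
have [n] := ubnP (size q); elim: n => // n IH in q *; rewrite ltnS => sq oq rq i.
have [sq'|] := ltnP (size q) n; first exact: IH.
move=> sq'; have {sq'}sq : size q = n by apply/eqP; rewrite eqn_leq sq.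
case: n => [|[|n]] in IH sq.
- by move/eqP: sq; rewrite size_poly_eq0 => /eqP ->; rewrite coef0.
- have /eqP/size_poly1P[c c0 qc] := sq.
  by move: rq c0; rewrite qc rootC => ->.
have ocx := integral_lead oq rq; set c := lead_coef q in ocx.
have oc : O c by rewrite /c lead_coefE.
pose q' := q - c *: 'X^(n.+1) + (c * x) *: 'X^n.
have q'i j : q'`_j = q`_j - c * (j == n.+1)%:R + c * x * (j == n)%:R.
  by rewrite !coefE.
have Sq' : S q'`_i.
  apply: IH.
  - rewrite ltnS; apply/leq_sizeP => j; rewrite q'i leq_eqVlt => /orP[/eqP <-|nj].
      rewrite eqxx gtn_eqF // /c lead_coefE sq /=; ring.
    rewrite nth_default ?sq // !gtn_eqF //; last exact: ltnW.
    by rewrite !mulr0 subrr addr0.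
  - move=> j; rewrite q'i; apply: integralD; last by apply: integralM => //; apply: nat_integral.
    by apply: integralB => //; apply: integralM => //; apply: nat_integral.
  - by rewrite /root !hornerE (rootP rq) exprS; apply/eqP; ring.
have -> : q`_i = q'`_i + (if i == n.+1 then c else 0) + (if i == n then - (c * x) else 0).
  by rewrite q'i; do 2!case: eqP => _; rewrite ?mulr1 ?mulr0; ring.
by apply: (SD); [apply: (SD) => // |]; case: ifP => _ //; [apply: Sc | apply: Scx].
Qed.

(** Take an integer relation between powers of x with a coefficient prime to p, hence outside m. By
    [coef_split] it equals u + v x with u, v, u x and v x integral. If u is outside m, then x = (u
    x) / u; otherwise v x is outside m and x^-1 = v / (v x). *)
Lemma loc_val x : V x \/ V x^-1.
Proof.
have [p pp mp] := prime_contains_int.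
pose k := (\dim {:K}).+1.
have [c [[i ci] cs]] := @int_dependence k (fun i => x ^+ i) p pp (ltnSn _).
pose q : {poly K} := \poly_(i < k) (c (inord i))%:~R.
have oq j : O q`_j.
  by rewrite coef_poly; case: ifP => _; [apply: int_integral | apply: integral_0].
have qx : root q x.
  rewrite /root horner_poly; apply/eqP; rewrite -[RHS]cs; apply: eq_bigr => j _.
  by rewrite inord_val.
have [u [v [ou ov oux ovx e]]] := coef_split oq qx i.
have {e} nm : ~ m (u + v * x).
  by rewrite -e coef_poly ltn_ord inord_val; apply: prime_int_notin ci.
have [mu|nu] := pselect (m u); last first.
  left; exists (u * x), u; split=> //; have := notin_neq0 nu => u0; by rewrite mulrC mulKf.
have nvx : ~ m (v * x) by move=> mvx; apply: nm; apply: mD.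
right; exists v, (v * x); split=> //; have := notin_neq0 nvx.
by rewrite mulf_eq0 negb_or => /andP[v0 x0]; field; rewrite ?v0 ?x0.
Qed.

Lemma notin_unit s : O s -> ~ m s -> vunit V s.
Proof.
move=> os ms; split; [exact: notin_neq0 | exact: loc_integral |].
by exists 1, s; split; rewrite ?div1r //; apply: integral_1.
Qed.

Lemma vmax_loc x : vmax V x <-> local_maximal_ideal O m x.
Proof.
split=> [[[a [b [oa ob mb e]]] nu]|[a [b [ma ob mb e]]]].
  exists a, b; split=> //; apply: contrapT => na; apply: nu.
  have ua := notin_unit oa na; have ub := notin_unit ob mb.
  by rewrite e; apply: vunitM; [apply: locM | | apply: vunitV].
have vx : V x by exists a, b; split=> //; apply: mO.
split=> // -[x0 _ [c [d [oc od md e']]]].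
have b0 := notin_neq0 mb; have d0 := notin_neq0 md.
apply: (notinM ob od mb md); have := mulfV x0; rewrite e' {1}e => h.
have -> : b * d = c * a by rewrite -[LHS]mulr1 -h; field; rewrite b0 d0.
exact: mM.
Qed.

(** The element t generates the localization of I at m; the multiplier s allows t itself to lie
    outside I. *)
Definition lgen (I : set K) t : Prop :=
  [/\ t != 0, exists s, [/\ O s, ~ m s & I (s * t)] & forall y, I y -> V (y / t)].

Lemma lgen_uniq (I : set K) t u : lgen I t -> lgen I u -> vunit V (t / u).
Proof.
have aux t1 u1 : lgen I t1 -> lgen I u1 -> V (t1 / u1).
  move=> [t0 [s [os ms Is]] _] [u0 _ /(_ _ Is) h].
  have [s0 _ vs] := notin_unit os ms.
  by have -> : t1 / u1 = s^-1 * (s * t1 / u1); [field; rewrite s0 u0 | apply: locM].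
move=> ht hu; split; [|exact: aux | by rewrite invf_div; apply: aux].
by case: ht hu => [t0 _ _] [u0 _ _]; rewrite mulf_neq0 ?invr_eq0.
Qed.

Lemma lgen_mul (I J : set K) t u : lgen I t -> lgen J u -> lgen (ideal_mul I J) (t * u).
Proof.
move=> [t0 [s [os ms Is]] It] [u0 [s' [os' ms' Js]] Ju]; split.
- exact: mulf_neq0.
- exists (s * s'); split; [exact: integralM | exact: notinM |].
  exists 1%N, (fun=> s * t), (fun=> s' * u); split=> //.
  by rewrite big_ord1; ring.
- move=> y [n [a [b [Ia Jb ->]]]]; rewrite mulr_suml.
  apply: (big_ind V); [exact: (val0 loc1 locB) | exact: (valD loc1 locB) |] => i _.
  have -> : a i * b i / (t * u) = a i / t * (b i / u) by field; rewrite t0 u0.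
  by apply: locM; [apply: It | apply: Ju].
Qed.

Lemma lgen_principal c : c != 0 -> lgen (principal O c) c.
Proof.
move=> c0; split=> // [|y [r Or ->]]; last by rewrite mulrC mulKf //; apply: loc_integral.
exists 1; split; rewrite ?mul1r //; first exact: integral_1.
by exists 1; rewrite ?mulr1 //; apply: integral_1.
Qed.

Lemma lgen_one : lgen O 1.
Proof.
split=> [||y Oy]; rewrite ?oner_neq0 ?divr1 //; last exact: loc_integral.
by exists 1; split; rewrite ?mulr1 //; apply: integral_1.
Qed.

(** * Nonzero ideals are locally principal *)

Section LocalGenerator.

(** The multiplier s is the same for all of S. This uniformity later places s / d in the inverse
    ideal. *)
Let fin (D S : set K) := exists d s, [/\ D d, O s, ~ m s
  & forall y, S y -> exists2 r, O r & s * y = r * d].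

(** In a valuation ring one of d1, d2 divides the other; the divisor serves for both sets. *)
Let fin_add (D S1 S2 S : set K) : fin D S1 -> fin D S2 ->
  S `<=` ideal_add S1 S2 -> fin D S.
Proof.
move=> [d1 [s1 [Dd1 Os1 ms1 h1]]] [d2 [s2 [Dd2 Os2 ms2 h2]]] hS.
have aux D1 D2 t1 t2 e1 e2 : D e1 -> D e2 -> O t1 -> O t2 -> ~ m t1 -> ~ m t2 ->
    (forall y, D1 y -> exists2 r, O r & t1 * y = r * e1) ->
    (forall y, D2 y -> exists2 r, O r & t2 * y = r * e2) ->
    (exists a b, [/\ O a, O b, ~ m b & b * e1 = a * e2]) ->
    exists d s, [/\ D d, O s, ~ m s
      & forall y1 y2, D1 y1 -> D2 y2 -> exists2 r, O r & s * (y1 + y2) = r * d].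
  move=> De1 De2 Ot1 Ot2 mt1 mt2 g1 g2 [a [b [Oa Ob mb e]]].
  exists e2, (t1 * t2 * b); split=> //; try by do ?apply: integralM.
    by apply: notinM => //; [apply: integralM | apply: notinM].
  move=> y1 y2 /g1[r1 Or1 f1] /g2[r2 Or2 f2]; exists (t2 * r1 * a + t1 * b * r2).
    by apply: integralD; do ?apply: integralM.
  transitivity (t2 * b * (t1 * y1) + t1 * b * (t2 * y2)); first ring.
  rewrite f1 f2; transitivity (t2 * r1 * (b * e1) + t1 * b * (r2 * e2)); first ring.
  by rewrite e; ring.
have triv e : exists a b, [/\ O a, O b, ~ m b & b * (0 : K) = a * e].
  exists 0, 1; split; rewrite ?mul1r ?mul0r //; [exact: integral_0 | exact: integral_1].
have quot e1 e2 : e2 != 0 -> V (e1 / e2) ->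
    exists a b, [/\ O a, O b, ~ m b & b * e1 = a * e2].
  move=> e20 [a [b [Oa Ob mb e]]]; exists a, b; split=> //.
  have b0 := notin_neq0 mb; rewrite -(divfK e20 e1) e; field; exact: b0.
have [c|c] : (exists a b, [/\ O a, O b, ~ m b & b * d1 = a * d2])
          \/ (exists a b, [/\ O a, O b, ~ m b & b * d2 = a * d1]).
- have [->|n2] := eqVneq d2 0; first by right; apply: triv.
  have [->|n1] := eqVneq d1 0; first by left; apply: triv.
  by have [h|] := loc_val (d1 / d2); [|rewrite invf_div => h]; [left|right]; apply: quot.
- have [d [s [? ? ? h]]] := aux _ _ _ _ _ _ Dd1 Dd2 Os1 Os2 ms1 ms2 h1 h2 c.
  by exists d, s; split=> // y /hS[y1 [y2 [? ? ->]]]; apply: h.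
- have [d [s [? ? ? h]]] := aux _ _ _ _ _ _ Dd2 Dd1 Os2 Os1 ms2 ms1 h2 h1 c.
  by exists d, s; split=> // y /hS[y1 [y2 [? ? ->]]]; rewrite addrC; apply: h.
Qed.

Let fin_span (D : set K) k (x : 'I_k -> K) : D 0 -> (forall i, D (x i)) ->
  fin D [set y | exists c : 'I_k -> K, (forall i, O (c i)) /\ y = \sum_i c i * x i].
Proof.
move=> D0; elim: k x => [|k IH] x Dx.
  exists 0, 1; split=> //; first exact: integral_1.
  move=> y [c [_ ->]]; exists 0; first exact: integral_0.
  by rewrite big_ord0 !mulr0.
apply: (fin_add (S1 := [set r * x ord0 | r in O]) _ (IH (fun i => x (lift ord0 i)) _)) => //.
  exists (x ord0), 1; split=> //; first exact: integral_1.
  by move=> y [r Or <-]; exists r; rewrite ?mul1r.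
move=> y [c [Oc ->]]; rewrite big_ord_recl; exists (c ord0 * x ord0).
by eexists; split; [exists (c ord0) | exists (fun i => c (lift ord0 i)) | ].
Qed.

(* A nonzero ideal contains some n > 0; peel off a prime factor q of n, using
   that O / q O is finite dimensional over F_q. *)
Lemma ideal_lgen (D : set K) : ideal O D -> nonzero D -> exists d s,
  [/\ D d, O s, ~ m s & forall y, D y -> exists2 r, O r & s * y = r * d].
Proof.
move=> hI hn; have [n n0 Dn] := ideal_contains_nat hI hn.
elim/ltn_ind: n => n IH in D {hn} hI n0 Dn *.
have [DO [D0 DD DM]] := hI; have O1 := integral_1.
have DN y : D y -> D (- y).
  by move=> Dy; rewrite -mulN1r; apply: DM => //; apply: integralN.
have [n1|n1] := leqP n 1.
  exists 1, 1; split=> //; first by have e : n = 1%N by [lia]; move: Dn; rewrite e.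
  by move=> y /DO Oy; exists y; rewrite // mulrC.
set q := pdiv n; have pq : prime q by apply: pdiv_prime.
have q0 : q%:R != 0 :> K by rewrite -[q%:R]/((q%:Z)%:~R); apply: intr_neq0; have := prime_gt0 pq; lia.
(* The quotient of the part of D inside q O by q: it contains the smaller integer n / q, so the
   induction hypothesis applies to it. *)
pose I := [set z | O z /\ D (q%:R * z)].
have hI' : ideal O I.
  split=> [z []//|]; split.
  - by split; rewrite ?mulr0 //; apply: integral_0.
  - by move=> x y [Ox Dx] [Oy Dy]; split; [apply: integralD | rewrite mulrDr; apply: DD].
  - by move=> x y Ox [Oy Dy]; split; [apply: integralM | rewrite mulrCA; apply: DM].
have nq : n = (n %/ q * q)%N by rewrite divnK // pdiv_dvd.
have lt : (n %/ q < n)%N by rewrite ltn_Pdiv ?prime_gt1.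
have gt0 : (0 < n %/ q)%N by rewrite divn_gt0 ?prime_gt0 // dvdn_leq // pdiv_dvd.
have Iq : I (n %/ q)%:R.
  by split; [apply: nat_integral | rewrite -natrM mulnC -nq].
have [d' [s' [[Od' Dd'] Os' ms' h']]] := IH _ lt I hI' gt0 Iq.
(* k elements of D independent over F_q in O / q O; by [int_dependence] k is at most the degree of
   K, so a maximal family exists. *)
pose Ind k := exists x : 'I_k -> K, (forall i, D (x i)) /\
  forall c : 'I_k -> int, (exists2 z, O z & \sum_i (c i)%:~R * x i = q%:R * z) ->
    forall i, (q%:Z %| c i)%Z.
have ex0 : exists k, `[<Ind k>].
  exists 0%N; apply/asboolP; exists (fun=> 0); by split=> // c _ [].
have ub k : `[<Ind k>] -> (k <= \dim {:K})%N.
  move=> /asboolP[x [Dx hx]]; rewrite leqNgt; apply/negP => dk.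
  have [c [[i ci] cs]] := int_dependence x pq dk.
  move/negP: ci; apply; apply: hx; exists 0; first exact: integral_0.
  by rewrite mulr0.
case: (ex_maxnP ex0 ub) => k /asboolP[x [Dx hx]] maxk.
apply: (fin_add (S2 := [set q%:R * z | z in I]) (fin_span D0 Dx)).
  exists (q%:R * d'), s'; split=> // _ [z Iz <-]; have [r Or e] := h' z Iz.
  by exists r => //; rewrite mulrCA e mulrCA.
move=> y Dy; have Oy := DO _ Dy.
pose x' (i : 'I_k.+1) := if unlift ord0 i is Some j then x j else y.
have : ~ Ind k.+1 by move=> /asboolP /maxk; rewrite ltnn.
move/forallNP/(_ x')/not_andP; case.
  by case=> i; rewrite /x'; case: unliftP => [j _|_].
move/existsNP => [c /not_implyP[[z Oz]]].
rewrite big_ord_recl {1}/x' unlift_none => e /existsNP[i nci].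
have {}e : (c ord0)%:~R * y + \sum_i (c (lift ord0 i))%:~R * x i = q%:R * z.
  by rewrite -e; congr +%R; apply: eq_bigr => j _; rewrite /x' liftK.
(* If q divided the coefficient of y, the relation would already hold between the x_i modulo q O. *)
have nc0 : ~~ (q%:Z %| c ord0)%Z.
  apply/negP => c0; apply: nci.
  have [j ->|-> //] := unliftP ord0 i.
  apply: (hx (fun j => c (lift ord0 j))); have [b be] := dvdzP c0.
  exists (z - b%:~R * y); first by apply: integralB => //; apply: integralM => //; apply: int_integral.
  rewrite mulrBr -e be intrM -[(q%:Z)%:~R]/(q%:R : K); ring.
have : coprimez q (c ord0) by rewrite coprimezE prime_coprime.
move=> /coprimezP[[u v] /= euv].
have {}euv : u%:~R * q%:R + v%:~R * (c ord0)%:~R = 1 :> K.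
  by rewrite -[q%:R]/((q%:Z)%:~R) -!intrM -intrD euv.
pose w := \sum_i (v * c (lift ord0 i))%:~R * x i.
have we : w = v%:~R * (q%:R * z - (c ord0)%:~R * y).
  by rewrite -e addrC addKr mulr_sumr; apply: eq_bigr => j _; rewrite intrM mulrA.
(* Inverting the coefficient of y modulo q writes y as an integer combination of the x_i plus q
   times an element of [I]. *)
have ye : y = - w + q%:R * (v%:~R * z + u%:~R * y).
  transitivity ((u%:~R * q%:R + v%:~R * (c ord0)%:~R) * y); first by rewrite euv mul1r.
  by rewrite we; ring.
have Dw : D w.
  by apply: big_ind => // j _; apply: DM => //; apply: int_integral.
exists (- w), (q%:R * (v%:~R * z + u%:~R * y)); split=> //.
  exists (fun i => (- (v * c (lift ord0 i)))%:~R); split=> [j|]; first exact: int_integral.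
  by rewrite -sumrN; apply: eq_bigr => j _; rewrite intrN mulNr.
exists (v%:~R * z + u%:~R * y) => //; split.
  by apply: integralD; apply: integralM => //; apply: int_integral.
by move: ye => /eqP; rewrite addrC -subr_eq opprK => /eqP <-; apply: DD.
Qed.

End LocalGenerator.

End Prime.
End Integers.

(** * Ideals of the ring of integers *)


Section Global.
Variable K : fieldExtType rat.
Notation O := (@ring_of_integers K).
Implicit Types (x y z : K) (I J D m : set K).

Lemma exists_prime_above I : ideal O I -> nonzero I -> ~ I 1 ->
  exists2 m, nonzero_prime_ideal O m & I `<=` m.
Proof.
move=> hI [i0 Ii0 i00] nI1; have [IO [I0 ID IM]] := hI.
(* Joining I takes care of the empty chain, whose union is empty. *)
pose P (A : set K) := ideal O (A `|` I) /\ ~ (A `|` I) 1.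
have [|A [[[AO [A0 AD AM]] A1] maxA]] := @Zorn_bigcup _ P.
  move=> S SP tS; split; last first.
    by move=> [[B SB B1]|//]; have [_] := SP _ SB; apply; left.
  split=> [x [[B SB Bx]|/IO //]|].
    by have [[h _] _] := SP _ SB; apply: h; left.
  split; first by right.
  - have big B x y : S B -> (B `|` I) x -> (B `|` I) y ->
        (\bigcup_(X in S) X `|` I) (x + y).
      move=> SB Bx By; have [[_ [_ h _]] _] := SP _ SB.
      by have [?|?] := h _ _ Bx By; [left; exists B | right].
    move=> x y [[B SB Bx]|Ix] [[C SC Cy]|Iy].
    + have [BC|CB] := tS _ _ SB SC.
        by apply: (big C) => //; left=> //; apply: BC.
      by apply: (big B) => //; left=> //; apply: CB.
    + by apply: (big B) => //; [left | right].
    + by apply: (big C) => //; [right | left].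
    + by right; apply: ID.
  - move=> x y Ox [[B SB By]|Iy]; last by right; apply: IM.
    have [[_ [_ _ h]] _] := SP _ SB.
    by have [|?|?] := h x y Ox; [left | left; exists B | right].
exists (A `|` I); last by move=> x; right.
split=> //; first by exists i0; [right|].
move=> x y Ox Oy Axy; have [Ax|nAx] := pselect ((A `|` I) x); [by left | right].
pose B := ideal_add (A `|` I) (principal O x).
have BI : B `|` I = B.
  apply/seteqP; split=> [t [//|It]|t]; last by left.
  exists t, 0; split; [by right | | by rewrite addr0].
  by exists 0; rewrite ?mulr0 //; apply: integral_0.
have AB : A `<=` B.
  move=> t At; exists t, 0; split; [by left | | by rewrite addr0].
  by exists 0; rewrite ?mulr0 //; apply: integral_0.
have Bx : B x.
  exists 0, x; split; [exact: A0 | | by rewrite add0r].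
  by exists 1; rewrite ?mulr1 //; apply: integral_1.
have hB : ideal O B.
  split=> [t [a [_ [/AO Oa [r Or ->] ->]]]|].
    by apply: integralD => //; apply: integralM.
  split.
  - exists 0, 0; split; [exact: A0 | | by rewrite addr0].
    by exists 0; rewrite ?mulr0 //; apply: integral_0.
  - move=> _ _ [a [_ [Aa [r Or ->] ->]]] [b [_ [Ab [s Os ->] ->]]].
    exists (a + b), (x * (r + s)); split; [exact: AD | | ring].
    by exists (r + s) => //; apply: integralD.
  - move=> t _ Ot [a [_ [Aa [r Or ->] ->]]].
    exists (t * a), (x * (t * r)); split; [exact: AM | | ring].
    by exists (t * r) => //; apply: integralM.
have B1 : B 1.
  apply: contrapT => nB1; apply: (maxA B); last by rewrite /P BI.
  by split=> // BA; apply: nAx; left; apply: BA.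
have [a [_ [Aa [r Or ->] e]]] := B1.
have -> : y = y * a + r * (x * y) by rewrite -[LHS]mulr1 e; ring.
by apply: AD; apply: AM.
Qed.

Lemma integral_fraction x : exists2 c : K, c != 0 & O c /\ O (c * x).
Proof.
have [q q0 qx] := int_poly_root x.
have oq i : O (map_poly intr q)`_i by rewrite coef_map; apply: int_integral.
exists (lead_coef (map_poly intr q : {poly K})).
  rewrite lead_coef_eq0 map_poly_eq0_id0 //.
  by apply: intr_neq0; rewrite lead_coef_eq0.
by split; [rewrite lead_coefE | apply: integral_lead => //; apply/rootP].
Qed.

(** For y in I, the integral s with s y in J form an ideal. A common local generator gives it an
    element outside each prime, so it contains 1. *)
Lemma local_sub I J : submodule O I -> submodule O J -> nonzero J ->
  (forall m, nonzero_prime_ideal O m -> exists t, lgen m I t /\ lgen m J t) ->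
  I `<=` J.
Proof.
move=> [I0 ID IM] [J0 JD JM] [j Jj /eqP j0] h y Iy.
pose C := [set s | O s /\ J (s * y)].
have hC : ideal O C.
  split=> [s []//|]; split; first by split; [exact: integral_0 | rewrite mul0r].
  - by move=> a b [? ?] [? ?]; split; [apply: integralD | rewrite mulrDl; apply: JD].
  - by move=> a b ? [? ?]; split; [apply: integralM | rewrite -mulrA; apply: JM].
have nC : nonzero C.
  have [c c0 [Oc Ocy]] := integral_fraction (y / j).
  exists c; last exact/eqP.
  by split=> //; have -> : c * y = c * (y / j) * j; [field | apply: JM].
apply: contrapT => nJy; have nC1 : ~ C 1 by move=> [_]; rewrite mul1r.
have [m hm Cm] := exists_prime_above hC nC nC1.
have [t [[t0 _ hI] [_ [s [Os ms Js]] _]]] := h m hm.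
have [a [b [Oa Ob mb e]]] := hI _ Iy.
have b0 : b != 0.
  by apply/eqP => b0; apply: mb; rewrite b0; case: hm => -[_ []].
have : m (s * b).
  apply: Cm; split; first exact: integralM.
  have -> : s * b * y = a * (s * t) by rewrite -(divfK t0 y) e; field.
  exact: JM.
by case: hm => _ _ _ /(_ s b Os Ob) hp /hp[].
Qed.

Lemma local_eq I J : submodule O I -> submodule O J -> nonzero I -> nonzero J ->
  (forall m, nonzero_prime_ideal O m -> exists t, lgen m I t /\ lgen m J t) ->
  I = J.
Proof.
move=> hI hJ nI nJ h; apply/seteqP; split; apply: local_sub => // m hm.
by have [t [? ?]] := h m hm; exists t.
Qed.

Lemma submodule_mul I J : submodule O J -> submodule O (ideal_mul I J).
Proof.
move=> [J0 JD JM]; split.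
- by exists 0%N, (fun=> 0), (fun=> 0); split=> [[]//|[]//|]; rewrite big_ord0.
- move=> _ _ [n [u [v [Iu Jv ->]]]] [k [a [b [Ia Jb ->]]]].
  exists (n + k)%N, (fun i => match split i with inl j => u j | inr j => a j end),
    (fun i => match split i with inl j => v j | inr j => b j end).
  split; [by move=> i; case: split | by move=> i; case: split |].
  rewrite big_split_ord /=; congr +%R; apply: eq_bigr => i _.
    by rewrite (unsplitK (inl i)).
  by rewrite (unsplitK (inr i)).
- move=> x _ Ox [n [u [v [Iu Jv ->]]]]; exists n, u, (fun i => x * v i).
  split=> // [i|]; first exact: JM.
  by rewrite mulr_sumr; apply: eq_bigr => i _; rewrite mulrCA.
Qed.

Lemma submodule_inv I : submodule O (ideal_inv O I).
Proof.
split=> [y _|x y hx hy z Iz|x y Ox hy z Iz].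
- by rewrite mul0r; apply: integral_0.
- by rewrite mulrDl; apply: integralD; [apply: hx | apply: hy].
- by rewrite -mulrA; apply: integralM => //; apply: hy.
Qed.

Lemma submodule_O : submodule O O.
Proof. split; [exact: integral_0 | exact: integralD | exact: integralM]. Qed.

Lemma nonzero_mul I J : nonzero I -> nonzero J -> nonzero (ideal_mul I J).
Proof.
move=> [a Ia /eqP a0] [b Jb /eqP b0]; exists (a * b); last by apply/eqP/mulf_neq0.
by exists 1%N, (fun=> a), (fun=> b); rewrite big_ord1.
Qed.

Lemma nonzero_inv I : ideal O I -> nonzero (ideal_inv O I).
Proof.
move=> [IO _]; exists 1; last exact/eqP/oner_neq0.
by move=> y /IO; rewrite mul1r.
Qed.

Lemma nonzero_O : nonzero O.
Proof. by exists 1; [exact: integral_1 | exact/eqP/oner_neq0]. Qed.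

(** The uniform multiplier s of [ideal_lgen] satisfies s / d in the inverse ideal, so one d handles
    D and its inverse together. *)
Lemma lgen_ideal m D : nonzero_prime_ideal O m -> ideal O D -> nonzero D ->
  exists d, [/\ localization O m d, lgen m D d & lgen m (ideal_inv O D) d^-1].
Proof.
move=> hm hD hn; have [d [s [Dd Os ms h]]] := ideal_lgen hm hD hn.
have [DO _] := hD; have us := notin_unit hm Os ms; have [s0 _ vs] := us.
have d0 : d != 0.
  have [y Dy /eqP y0] := hn; have [r Or e] := h y Dy.
  by apply: contra_eq_neq e => ->; rewrite mulr0 mulf_neq0.
exists d; split; first by apply: loc_integral => //; apply: DO.
- split=> // [|y Dy].
    exists 1; rewrite mul1r; split=> //; first exact: integral_1.
    by case: hm.
  have [r Or e] := h y Dy.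
  have -> : y / d = s^-1 * r.
    by apply: (mulIf d0); rewrite divfK // -mulrA -e mulKf.
  by apply: locM => //; apply: loc_integral.
- split=> [||y hy]; rewrite ?invr_eq0 //.
    exists s; split=> // y /h[r Or e].
    by have -> : s / d * y = r; [apply: (mulIf d0); rewrite -e; field|].
  by rewrite invrK; apply: loc_integral => //; apply: hy.
Qed.

Lemma ideal_mul_inv D : ideal O D -> nonzero D -> ideal_mul D (ideal_inv O D) = O.
Proof.
move=> hD hn; apply: local_eq.
- exact/submodule_mul/submodule_inv.
- exact: submodule_O.
- by apply: nonzero_mul => //; apply: nonzero_inv.
- exact: nonzero_O.
move=> m hm; exists 1; split; last exact: lgen_one.
have [d [_ hd hd']] := lgen_ideal hm hD hn; have [d0 _ _] := hd.
by rewrite -(mulfV d0); apply: lgen_mul.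
Qed.

(** Locally x generates A D^-2, so d^2 x is a unit times a generator of A, and A + D = O makes that
    generator or d a unit. *)
Lemma denominator_vden m x y D d : nonzero_prime_ideal O m ->
  is_denominator (Affine x y) D -> lgen m D d ->
  vden (localization O m) (d ^+ 2) x.
Proof.
move=> hm [hD nD [A [hA AD xE]]] hd.
have vv1 := loc1 hm; have vB := @locB _ _ hm; have vM := @locM _ _ hm.
have [d1 [_ hd1 hdi]] := lgen_ideal hm hD nD.
have [d0 [s [Os ms Ds]] hdV] := hd; have [DO _] := hD; have [AO [A0 _ AM]] := hA.
have vd : localization O m d.
  have [s0 _ vs] := notin_unit hm Os ms; rewrite -(mulKf s0 d).
  by apply: vM => //; apply: loc_integral => //; apply: DO.
have Dinv1 : ideal_inv O D 1 by move=> z /DO; rewrite mul1r.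
have [a [b [Aa Db e1]]] : ideal_add A D 1 by rewrite AD; apply: integral_1.
(* For x = 0 the ideal A is zero and has no local generator; coprimality then puts 1 in D. *)
have [x0|x0] := eqVneq x 0.
  have a0 : a = 0.
    have : principal O x a.
      rewrite xE; exists 1%N, (fun=> a), (fun=> 1); split=> //; last by rewrite big_ord1 mulr1.
      by move=> _; exists 1%N, (fun=> 1), (fun=> 1); split=> //; rewrite big_ord1 mulr1.
    by move=> [r _ ->]; rewrite x0 mul0r.
  have ud : vunit (localization O m) d.
    by split=> //; have := hdV b Db; rewrite -[b]add0r -{1}a0 -e1 div1r.
  rewrite x0; split; rewrite ?mulr0 ?expf_neq0 //; [exact: valX | exact: (val0 vv1 vB) |].
  by left; apply: vunitX.
have nA : nonzero A.
  apply: contrapT => nA; have : principal O x x.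
    by exists 1; rewrite ?mulr1 //; apply: integral_1.
  rewrite xE => -[n [u [v [Au _ xe]]]]; move/eqP: x0; apply; rewrite xe.
  rewrite big1 // => i _; have [->|ui] := eqVneq (u i) 0; first by rewrite mul0r.
  by case: nA; exists (u i) => //; apply/eqP.
have [al [val hal _]] := lgen_ideal hm hA nA.
have [d10 _ _] := hd1; have [al0 _ halV] := hal.
have u1 := lgen_uniq hm (lgen_principal hm x0) (eq_ind_r (lgen m ^~ _) (lgen_mul hm hal (lgen_mul hm hdi hdi)) xE).
have u2 := lgen_uniq hm hd hd1.
have [r ur re] : exists2 r, vunit (localization O m) r & d ^+ 2 * x = al * r.
  exists (x / (al * (d1^-1 * d1^-1)) * (d / d1) ^+ 2).
    by apply: vunitM => //; apply: vunitX.
  by field; rewrite al0 d10.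
split; rewrite ?expf_neq0 //; first exact: valX.
  by rewrite re; apply: vM => //; case: ur.
have [ud|md] := val_cases vd; first by left; apply: vunitX.
have [ua|ma] := val_cases val; first by right; rewrite re; apply: vunitM.
case: (@vmax_unit _ (localization O m) 1); last exact: vunit1.
rewrite e1 -(divfK al0 a) -(divfK d0 b); apply: vmaxD => //.
- exact: loc_val.
- by apply: vmaxMr => //; apply: halV.
- by apply: vmaxMr => //; apply: hdV.
Qed.

End Global.

(** * Parallelogram law for the local quotients *)


Section FractionalIdeals.
Variable K : fieldExtType rat.
Notation O := (@ring_of_integers K).

Lemma lgen_unit (m I : set K) t u : nonzero_prime_ideal O m -> submodule O I ->
  lgen m I t -> vunit (localization O m) (t / u) -> lgen m I u.
Proof.
move=> hm [_ _ IM] [t0 [s [Os ms Is]] It] ut; have [tu0 vtu vut] := ut.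
have u0 : u != 0 by move: tu0; rewrite mulf_eq0 invr_eq0 negb_or => /andP[].
split=> // [|y Iy].
  move: vut; rewrite invf_div => -[a [b [Oa Ob mb e]]]; exists (s * b).
  have b0 : b != 0 by apply/eqP => b0; apply: mb; rewrite b0; case: hm => -[_ []].
  split; first exact: integralM.
    by case: hm => _ _ _ h /(h _ _ Os Ob)[].
  have -> : s * b * u = a * (s * t) by rewrite -(divfK t0 u) e; field.
  exact: IM.
have -> : y / u = y / t * (t / u) by field; rewrite t0 u0.
by apply: locM => //; apply: It.
Qed.

Lemma ideal_inv_inv (D : set K) t : ideal O D -> nonzero D ->
  ideal_inv O (ideal_inv O D) t -> D t.
Proof.
move=> hD nD ht; have : ideal_mul D (ideal_inv O D) 1.
  by rewrite ideal_mul_inv //; apply: integral_1.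
have [_ [D0 DD DM]] := hD.
move=> [n [d [e [Dd De s1]]]]; rewrite -[t]mulr1 s1 mulr_sumr.
apply: (big_ind D) => // i _; rewrite mulrCA mulrC; apply: DM => //; exact: ht.
Qed.

Lemma fractional_quotient (D : set K) c : c != 0 -> ideal O D -> nonzero D ->
  let g := ideal_mul (principal O c) (ideal_inv O D) in
  fractional_ideal O g /\ D = ideal_mul (principal O c) (ideal_inv O g).
Proof.
move=> c0 hD nD g; have [DO [D0 DD DM]] := hD; split.
  split; first exact/submodule_mul/submodule_inv.
    apply: nonzero_mul; last exact: nonzero_inv.
    by exists c; [exists 1; rewrite ?mulr1 //; apply: integral_1 | apply/eqP].
  have [d Dd /eqP d0] := nD; have [e e0 [Oe Oec]] := integral_fraction c.
  exists (e * d); split; [exact/integralM/DO | exact/eqP/mulf_neq0 |].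
  move=> _ [n [u [v [cu Dv ->]]]]; rewrite mulr_sumr; apply: integral_sum => i.
  have [r Or ->] := cu i.
  have -> : e * d * (c * r * v i) = e * c * r * (v i * d) by ring.
  by apply: integralM; [apply: integralM | apply: Dv].
apply/seteqP; split=> [y Dy|_ [n [u [v [cu gv ->]]]]].
  exists 1%N, (fun=> c), (fun=> y / c); split=> [_|_|].
  - by exists 1; rewrite ?mulr1 //; apply: integral_1.
  - move=> _ [n [u [v [cu Dv ->]]]]; rewrite mulr_sumr; apply: integral_sum => i.
    have [r Or ->] := cu i.
    have -> : y / c * (c * r * v i) = r * (v i * y) by field.
    by apply: integralM => //; apply: Dv.
  - by rewrite big_ord1 mulrC divfK.
apply: (big_ind D) => // i _; have [r Or ->] := cu i.
rewrite mulrAC mulrC; apply: DM => //; apply: ideal_inv_inv => // z Dz.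
rewrite (mulrC c) -mulrA; apply: gv; exists 1%N, (fun=> c), (fun=> z).
split=> [_|//|]; last by rewrite big_ord1.
by exists 1; rewrite ?mulr1 //; apply: integral_1.
Qed.

End FractionalIdeals.

(** * The quotients psi_a / d_a at a fixed prime *)

Section LocalQuadratic.
Variables (K : fieldExtType rat) (E : weierstrass K).
Notation O := (@ring_of_integers K).
Hypothesis ha : [/\ O (a1 E), O (a2 E), O (a3 E), O (a4 E) & O (a6 E)].
Variable f : int * int -> ec_point K.
Hypothesis fD : forall u v : int * int, f (u + v) = add_point E (f u) (f v).
Hypothesis f_inj0 : forall u : int * int, f u = Infinity -> u = 0.
Hypothesis f_curve : forall u : int * int, on_curve E (f u).
Variable W : int * int -> K.
Hypothesis netW : is_net_polynomials E (f (1, 0)) (f (0, 1)) W.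
Variable m : set K.
Hypothesis hm : nonzero_prime_ideal O m.
Notation V := (localization O m).
Variable d : int * int -> K.
Hypothesis hd : forall u : int * int, u != 0 -> vden V (d u ^+ 2) (px f u).

(** The value 1 at 0 is a local generator of g_0 = O_K, and with it the parallelogram law has no
    exceptions. *)
Definition net_quotient u := if u == 0 then 1 else W u / d u.
Notation t := net_quotient.

Let v1 := loc1 hm.
Let vB := @locB _ _ hm.
Let vM := @locM _ _ hm.
Let vor := loc_val hm.

Let d0 u : u != 0 -> d u != 0.
Proof. by case/hd; rewrite expf_eq0. Qed.

Let W0 u : u != 0 -> W u != 0.
Proof. exact: (net_neq0 fD f_inj0 f_curve netW). Qed.

Let t0 u : t u != 0.
Proof.
rewrite /t; have [_|u0] := eqVneq u 0; first exact: oner_neq0.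
by rewrite mulf_neq0 ?invr_eq0 ?W0 ?d0.
Qed.

Lemma vden_uniq x z z' : vden V z x -> vden V z' x -> vunit V (z / z').
Proof.
have aux z1 z2 : vden V z1 x -> vden V z2 x -> V (z1 / z2).
  move=> [z10 vz1 vx1 _] [z20 _ _ [[_ _ vz2]|[zx0 _ vz2]]]; first exact: vM.
  have x0 : x != 0 by move: zx0; rewrite mulf_eq0 negb_or => /andP[].
  by have -> : z1 / z2 = z1 * x / (z2 * x); [field; rewrite x0 z20 | exact: vM].
move=> h h'; split; [|exact: aux | by rewrite invf_div; apply: aux].
by case: h h' => [? _ _ _] [? _ _ _]; rewrite mulf_neq0 ?invr_eq0.
Qed.

Let smooth_at u : nonsingular_reduction E m (f u) -> u != 0 ->
  vsmooth V E (px f u) (py f u).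
Proof.
move=> h u0 [vx vy mn mp]; move: h; rewrite (f_affine f_inj0 u0) /= => /(_ vx vy).
apply; split; apply/vmax_loc => //.
have -> : a1 E * py f u - 3 * px f u ^+ 2 - 2 * a2 E * px f u - a4 E
   = - tangent_num E (px f u) (py f u) by rewrite /tangent_num; ring.
exact: vmaxN.
Qed.

Let tN u : vunit V (t (- u) / t u).
Proof.
rewrite /t oppr_eq0; have [u0|u0] := eqVneq u 0; first by rewrite divr1; apply: vunit1.
rewrite (netN f_inj0 netW).
have -> : - W u / d (- u) / (W u / d u) = - (d u / d (- u)).
  by field; rewrite W0 // !d0 // oppr_eq0.
apply: vunitN => //; apply: vunit_sqr => //; rewrite expr_div_n.
apply: (vden_uniq (x := px f u)); first exact: hd.
by have := hd (_ : - u != 0); have [-> _] := fN fD f_inj0 u0; apply; rewrite oppr_eq0.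
Qed.

Let val_a : [/\ V (a1 E), V (a2 E), V (a3 E), V (a4 E) & V (a6 E)].
Proof. by case: ha => *; split; apply: loc_integral. Qed.

Let t_double u : u != 0 -> nonsingular_reduction E m (f u) ->
  vunit V (t (u + u) / t u ^+ 4).
Proof.
move=> u0 ns; have uu0 := double_neq0 u0.
apply: vunit_sqr => //; rewrite /t (negPf uu0) (negPf u0).
have p0 := psi2_neq0 fD f_inj0 u0; have cu := px_curve f_inj0 f_curve u0.
have [va1 va2 va3 va4 va6] := val_a.
have := vden_double v1 vB vM vor va1 va2 va3 va4 va6 cu (smooth_at ns u0) p0 _
          (hd u0) (hd uu0).
rewrite (px_double fD f_inj0 u0) => /(_ (double_xE p0 cu)).
rewrite (net_double fD f_inj0 f_curve netW u0).
congr (vunit V _); field; rewrite W0 // !d0 //.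
Qed.

(** The abscissae determine only squares of the d's, so the law is proved squared and [vunit_sqr]
    takes the root. [vden_add] needs distinct abscissae; u = v and u = -v go through [t_double], and
    u = 0 or v = 0 through oddness and t_0 = 1. *)
Lemma net_quotient_parallelogram u v :
    nonsingular_reduction E m (f u) \/ nonsingular_reduction E m (f v) ->
  vunit V (t (u + v) * t (u - v) / (t u ^+ 2 * t v ^+ 2)).
Proof.
have tz : t 0 = 1 by rewrite /t eqxx.
have [->|u0] := eqVneq u 0.
  move=> _; rewrite add0r sub0r tz.
  have -> : t v * t (- v) / (1 ^+ 2 * t v ^+ 2) = t (- v) / t v by field; exact: t0.
  exact: tN.
have [->|v0] := eqVneq v 0.
  move=> _; rewrite addr0 ?subr0 tz.
  have -> : t u * t u / (t u ^+ 2 * 1 ^+ 2) = 1 by field; exact: t0.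
  exact: vunit1.
have [->|uv] := eqVneq u v.
  move=> ns; have {}ns : nonsingular_reduction E m (f v) by case: ns.
  rewrite subrr tz mulr1 -exprD; exact: t_double.
have [e|uNv] := eqVneq u (- v).
  case=> ns.
    have ev : v = - u by rewrite e opprK.
    rewrite ev subrr tz mul1r opprK.
    have -> : t (u + u) / (t u ^+ 2 * t (- u) ^+ 2)
       = t (u + u) / t u ^+ 4 * ((t (- u) / t u)^-1) ^+ 2 by field; rewrite !t0.
    apply: vunitM => //; first exact: t_double.
    by apply: vunitX => //; apply: vunitV; apply: tN.
  rewrite e addNr tz mul1r -opprD.
  have -> : t (- (v + v)) / (t (- v) ^+ 2 * t v ^+ 2)
      = t (- (v + v)) / t (v + v) * (t (v + v) / t v ^+ 4) * ((t (- v) / t v)^-1) ^+ 2.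
    by field; rewrite !t0.
  apply: vunitM => //; last by apply: vunitX => //; apply: vunitV; apply: tN.
  by apply: vunitM => //; apply: t_double.
have p0 : u + v != 0 by rewrite addr_eq0.
have m0 : u - v != 0 by rewrite subr_eq0.
have mE : px f (v - u) = px f (u - v).
  by have [<- _] := fN fD f_inj0 m0; rewrite opprB.
have vu : v != u by rewrite eq_sym.
have vNu : v != - u by rewrite -eqr_oppLR eq_sym.
have cu := px_curve f_inj0 f_curve u0; have cv := px_curve f_inj0 f_curve v0.
have [va1 va2 va3 va4 va6] := val_a.
have add := vden_add v1 vB vM vor va1 va2 va3 va4 va6.
have xvu := px_inj fD f_inj0 f_curve u0 v0 uv uNv.
have xuv := px_inj fD f_inj0 f_curve v0 u0 vu vNu.
move=> ns; apply: vunit_sqr => //.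
have -> : (t (u + v) * t (u - v) / (t u ^+ 2 * t v ^+ 2)) ^+ 2
  = (px f v - px f u) ^+ 2 * (d u ^+ 2) ^+ 2 * (d v ^+ 2) ^+ 2
    / (d (u + v) ^+ 2 * d (u - v) ^+ 2).
  rewrite /t (negPf u0) (negPf v0) (negPf p0) (negPf m0).
  transitivity ((W (u + v) * W (u - v)) ^+ 2 * (d u ^+ 2) ^+ 2 * (d v ^+ 2) ^+ 2
    / (d (u + v) ^+ 2 * d (u - v) ^+ 2) / (W u ^+ 2 * W v ^+ 2) ^+ 2).
    by field; rewrite !W0 // !d0.
  rewrite (net_x_diff fD f_inj0 f_curve netW u0 v0).
  by field; rewrite !W0 // !d0.
case: ns => ns.
  apply: (add _ _ _ _ _ _ _ _ _ cu (smooth_at ns u0) xvu _ _ (hd u0) (hd v0) (hd p0) (hd m0)).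
    by rewrite -mE (pxD fD f_inj0 f_curve u0 v0 uv uNv) (pxB fD f_inj0 f_curve u0 v0 uv uNv) chord_x_sum.
  by rewrite -mE (pxD fD f_inj0 f_curve u0 v0 uv uNv) (pxB fD f_inj0 f_curve u0 v0 uv uNv) chord_x_prod.
have -> : (px f v - px f u) ^+ 2 * (d u ^+ 2) ^+ 2 * (d v ^+ 2) ^+ 2
  = (px f u - px f v) ^+ 2 * (d v ^+ 2) ^+ 2 * (d u ^+ 2) ^+ 2 by ring.
apply: (add _ _ _ _ _ _ _ _ _ cv (smooth_at ns v0) xuv _ _ (hd v0) (hd u0) (hd p0) (hd m0)).
  by rewrite (addrC u v) (pxD fD f_inj0 f_curve v0 u0 vu vNu) (pxB fD f_inj0 f_curve v0 u0 vu vNu) chord_x_sum.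
by rewrite (addrC u v) (pxD fD f_inj0 f_curve v0 u0 vu vNu) (pxB fD f_inj0 f_curve v0 u0 vu vNu) chord_x_prod.
Qed.

End LocalQuadratic.

(** * Complex multiplication *)


Section BaseChange.
Variables (F L : fieldType) (iota : {rmorphism F -> L}) (E : weierstrass F).

Lemma map_point_inj : injective (map_point iota).
Proof. by move=> [|x y] [|x' y'] //= [/fmorph_inj -> /fmorph_inj ->]. Qed.

Lemma map_add_point P Q : map_point iota (add_point E P Q)
  = add_point (map_weierstrass iota E) (map_point iota P) (map_point iota Q).
Proof.
case: P Q => [|x1 y1] [|x2 y2] //=.
rewrite (inj_eq (fmorph_inj iota)).
rewrite -!rmorphM -!rmorphD fmorph_eq0; case: ifP => //= _.
case: eqP => _ /=; congr Affine;
  by rewrite !(rmorph_nat, rmorphXn, fmorphV, rmorphB, rmorphN, rmorphM, rmorphD).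
Qed.

Lemma map_on_curve Q :
  on_curve (map_weierstrass iota E) (map_point iota Q) <-> on_curve E Q.
Proof.
case: Q => [|x y] //=; rewrite -!rmorphXn -!rmorphM -!rmorphD.
by split=> [/fmorph_inj|->].
Qed.

End BaseChange.

Section CMPoints.
Variables (K : fieldExtType rat) (iota : {rmorphism K -> algC}).
Variables (E : weierstrass K) (w : K) (cm : cm_structure iota E w).
Hypothesis hw : imaginary_quadratic_integer w.
Variable P : ec_point K.
Hypotheses (hP : on_curve E P) (hnt : ~ torsion E P).

Definition zlin (u : int * int) : K := u.1%:~R + u.2%:~R * w.
Definition cm_point (u : int * int) : ec_point K := cm_act cm (zlin u) P.

Lemma zlin_Zadjoin u : Zadjoin w (zlin u).
Proof. by exists u.1, u.2. Qed.

Lemma zlinD u v : zlin (u + v) = zlin u + zlin v.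
Proof. by rewrite /zlin /= !intrD; ring. Qed.

Lemma zlinB u v : zlin (u - v) = zlin u - zlin v.
Proof. by rewrite /zlin /= !intrD !intrN; ring. Qed.

Let hP' : on_curve (map_weierstrass iota E) (map_point iota P).
Proof. exact/map_on_curve. Qed.

Let cm_pointE u : map_point iota (cm_point u) = cm_geom cm (zlin u) (map_point iota P).
Proof. by apply: cm_restrict => //; apply: zlin_Zadjoin. Qed.

Lemma cm_pointD u v : cm_point (u + v) = add_point E (cm_point u) (cm_point v).
Proof.
apply: (@map_point_inj _ _ iota); rewrite map_add_point !cm_pointE zlinD.
by apply: cm_add => //; apply: zlin_Zadjoin.
Qed.

Lemma cm_point_curve u : on_curve E (cm_point u).
Proof.
apply/(map_on_curve iota); rewrite cm_pointE.
by have [_ h _] := cm_endo cm (zlin_Zadjoin u); apply: h.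
Qed.

Lemma cm_point1 : cm_point (1, 0) = P.
Proof.
apply: (@map_point_inj _ _ iota); rewrite cm_pointE.
by rewrite /zlin /= mul0r addr0; apply: cm_one.
Qed.

Let cm_point_iter n : cm_point (Posz n, 0) = iter n (add_point E P) Infinity.
Proof.
elim: n => [|n IH]; first exact: (f_zero cm_pointD).
by rewrite iterS -IH -{1}cm_point1 -cm_pointD; congr (cm_point _).
Qed.

(* The complex conjugate of a + b w is a + b t - b w, where t is the trace of w. *)
Let norm_zlin u : u != 0 -> exists v (n : nat), [/\ (0 < n)%N & zlin v * zlin u = n%:R].
Proof.
case: u => a b; rewrite pair_eqb /= => ab0.
have [t [n [e disc]]] := hw.
pose N := a ^+ 2 + a * b * t + b ^+ 2 * n.
have N0 : 0 < N.
  have : 0 < 4 * N.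
    (* Completing the square shows the norm positive, the discriminant t^2 - 4n being negative. *)
    have -> : 4 * N = (2 * a + b * t) ^+ 2 + b ^+ 2 * (4 * n - t ^+ 2) by rewrite /N; ring.
    have [b0|b0] := eqVneq b 0.
      move: ab0; rewrite b0 andbT => a0.
      by rewrite mul0r expr0n /= mul0r !addr0 exprn_even_gt0 //= mulf_neq0.
    rewrite ltr_wpDl ?sqr_ge0 // mulr_gt0 ?exprn_even_gt0 //=; lia.
  lia.
exists (a + b * t, - b), `|N|%N; split; first lia.
have -> : (`|N|%N)%:R = N%:~R :> K by rewrite -[X in X%:~R](gtz0_abs N0).
rewrite /N /zlin /= !(intrD, intrM, intrN, rmorphXn) /=.
have ww : w ^+ 2 = t%:~R * w - n%:~R.
  by apply/eqP; rewrite -subr_eq0; apply/eqP; rewrite -[RHS]e; ring.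
transitivity (a%:~R ^+ 2 + a%:~R * b%:~R * t%:~R + b%:~R ^+ 2 * (t%:~R * w - w ^+ 2) : K).
  by ring.
by rewrite ww; ring.
Qed.

Lemma zlin_eq0 u : zlin u = 0 -> u = 0.
Proof.
move=> h; apply/eqP; apply: contraT => /norm_zlin[v [n [n0]]].
rewrite h mulr0 => /esym/eqP; rewrite -[n%:R]/((n%:Z)%:~R).
by rewrite (negPf (intr_neq0 K _)) //; lia.
Qed.

(** Applying the conjugate endomorphism replaces the multiplier by its norm, a positive integer,
    which would make P torsion. *)
Lemma cm_point_inj0 u : cm_point u = Infinity -> u = 0.
Proof.
move=> h; apply/eqP; apply: contraT => /norm_zlin[v [n [n0 e]]].
case: hnt; exists n; split=> //; rewrite -cm_point_iter.
apply: (@map_point_inj _ _ iota); rewrite cm_pointE.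
have -> : zlin (Posz n, 0) = zlin v * zlin u by rewrite e /zlin /= mul0r addr0.
rewrite cm_mul //; try exact: zlin_Zadjoin.
rewrite -cm_pointE h /=.
by have [] := cm_endo cm (zlin_Zadjoin v).
Qed.

End CMPoints.

(** * Construction of the ideals and passage from local to global *)

Theorem theorem1p9 (K : fieldExtType rat) (iota : {rmorphism K -> algC})
    (E : weierstrass K)
    (ha : [/\ ring_of_integers (a1 E), ring_of_integers (a2 E),
              ring_of_integers (a3 E), ring_of_integers (a4 E)
            & ring_of_integers (a6 E)])
    (hE : discriminant E <> 0)
    (w : K) (hw : imaginary_quadratic_integer w)
    (cm : cm_structure iota E w)
    (P : ec_point K) (hP : on_curve E P) (hnt : ~ torsion E P)
    (D : K -> set K)
    (hD : forall x, Zadjoin w x -> is_denominator (cm_act cm x P) (D x))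
    (psi : K -> K) (hpsi : is_psi E w P (cm_act cm w P) psi)
    (alpha beta gamma : K)
    (halpha : Zadjoin w alpha) (hbeta : Zadjoin w beta)
    (hgamma : Zadjoin w gamma)
    (htwo : (lcm_annihilators cm P alpha /\ lcm_annihilators cm P beta) \/
            (lcm_annihilators cm P alpha /\ lcm_annihilators cm P gamma) \/
            (lcm_annihilators cm P beta /\ lcm_annihilators cm P gamma))
    (hab : is_pid (Zadjoin w) \/
           exists2 M, lcm_annihilators cm P M &
             [/\ multiple_of (Zadjoin w) alpha M \/
                 coprime_in (Zadjoin w) alpha M,
                 multiple_of (Zadjoin w) beta M \/
                 coprime_in (Zadjoin w) beta M
               & multiple_of (Zadjoin w) gamma M \/
                 coprime_in (Zadjoin w) gamma M]) :
  exists g : K -> set K,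
    let OK := @ring_of_integers K in
    (forall x, Zadjoin w x ->
       fractional_ideal OK (g x) /\
       D x = ideal_mul (principal OK (psi x)) (ideal_inv OK (g x))) /\
    psi (alpha + beta) * psi (alpha - beta) * psi gamma ^+ 2
      = psi (alpha + gamma) * psi (alpha - gamma) * psi beta ^+ 2
        - psi (beta + gamma) * psi (beta - gamma) * psi alpha ^+ 2 /\
    let T x y z :=
      ideal_mul (ideal_mul (g (x + y)) (g (x - y))) (ideal_mul (g z) (g z)) in
    T alpha beta gamma = T alpha gamma beta /\
    T alpha gamma beta = T beta gamma alpha.
Proof.
pose f := cm_point cm P; pose z := zlin w.
have fD := @cm_pointD _ _ _ _ cm _ hP : forall u v, f (u + v) = add_point E (f u) (f v).
have f0 := @cm_point_inj0 _ _ _ _ cm hw _ hP hnt : forall u, f u = Infinity -> u = 0.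
have fC := @cm_point_curve _ _ _ _ cm _ hP : forall u, on_curve E (f u).
have [W netW psiW] := hpsi.
have {}netW : is_net_polynomials E (f (1, 0)) (f (0, 1)) W.
  by rewrite /f (cm_point1 cm hP) /cm_point /zlin /= mul1r add0r.
have {}psiW u : psi (z u) = W u by rewrite psiW; case: u.
have zE x : Zadjoin w x -> exists u, x = z u by move=> [a [b ->]]; exists (a, b).
have z_eq0 u : (z u == 0) = (u == 0).
  apply/eqP/eqP => [/(zlin_eq0 hw) //|->]; rewrite /z /zlin /= mul0r addr0 //.
have W_neq0 := net_neq0 fD f0 fC netW.
have OK0 := integral_0 K; have OK1 := integral_1 K.
have hDz u : u != 0 -> is_denominator (Affine (px f u) (py f u)) (D (z u)).
  by move=> u0; rewrite -(f_affine f0 u0); apply: hD; apply: zlin_Zadjoin.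
pose OK := @ring_of_integers K.
pose g x := if x == 0 then OK else ideal_mul (principal OK (psi x)) (ideal_inv OK (D x)).
have hg x : Zadjoin w x -> fractional_ideal OK (g x) /\
    D x = ideal_mul (principal OK (psi x)) (ideal_inv OK (g x)).
  move=> /zE[u ->]; rewrite /g z_eq0; have [->|u0] := eqVneq u 0.
    split.
      split; [exact: submodule_O | exact: nonzero_O |].
      by exists 1; split=> //; [exact/eqP/oner_neq0 | move=> y; rewrite mul1r].
    have -> : D (z 0) = [set 0].
      by have := hD _ (zlin_Zadjoin w 0); rewrite -/(cm_point cm P 0) -/f (f_zero fD).
    have W0 : W 0 = 0 by move: netW; rewrite !(f_affine f0) // => -[_ []].
    apply/seteqP; split=> [_ ->|_ [n [a [b [ha' _ ->]]]]] /=.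
      by exists 0%N, (fun=> 0), (fun=> 0); split=> [[]//|[]//|]; rewrite big_ord0.
    by rewrite big1 // => i _; have [r _ ->] := ha' i; rewrite psiW W0 !mul0r.
  have [hI hn _] := hDz u u0.
  by apply: fractional_quotient => //; rewrite psiW W_neq0.
exists g; split=> //.
have [a ae] := zE _ halpha; have [b be] := zE _ hbeta; have [c ce] := zE _ hgamma.
have zD u v : z u + z v = z (u + v) by rewrite /z zlinD.
have zB u v : z u - z v = z (u - v) by rewrite /z zlinB.
split; first by rewrite ae be ce !zD !zB !psiW; exact: (net_relation f0 netW).
move=> T.
pose smooth u := forall m, nonzero_prime_ideal OK m -> nonsingular_reduction E m (f u).
have sm u : lcm_annihilators cm P (z u) -> smooth u.
  by move=> h m hm; have [] := h m hm.
have Tsub x y u : Zadjoin w u -> submodule OK (T x y u).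
  by move=> /hg[[h _ _] _]; apply/submodule_mul/submodule_mul.
have Tnz u v k : nonzero (T (z u) (z v) (z k)).
  have gn l : nonzero (g (z l)) by have [[]] := hg _ (zlin_Zadjoin w l).
  by rewrite /T zD zB; do ?apply: nonzero_mul.
(* The last premise, quantified over every t, says that the triples are permutations of each other;
   the t to which it is applied depends on a prime chosen later. *)
suff main u v k u' v' k' : smooth u \/ smooth v -> smooth u' \/ smooth v' ->
    (forall t : int * int -> K, t u * t v * t k = t u' * t v' * t k') ->
    T (z u) (z v) (z k) = T (z u') (z v') (z k').
  rewrite ae be ce in htwo *.
  by case: htwo => [|[]] [/sm s1 /sm s2]; split; apply: main;
    by [left | right | move=> t; ring].
move=> s s' perm; apply: local_eq => //; try exact/Tsub/zlin_Zadjoin.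
move=> m hm.
(* Local generators are chosen for all indices at once; at 0 the denominator is the zero ideal and
   the choice is a dummy. *)
have /boolp.choice[d hd] l : exists d, l != 0 ->
    [/\ localization OK m d, lgen m (D (z l)) d & lgen m (ideal_inv OK (D (z l))) d^-1].
  have [->|l0] := eqVneq l 0; first by exists 0.
  by have [hI hn _] := hDz l l0; have [d hd] := lgen_ideal hm hI hn; exists d.
have hden l : l != 0 -> vden (localization OK m) (d l ^+ 2) (px f l).
  by move=> l0; have [_ h _] := hd l l0; apply: denominator_vden (hDz l l0) h.
pose t := net_quotient W d.
have gt l : lgen m (g (z l)) (t l).
  rewrite /g z_eq0 /t /net_quotient; case: eqVneq => l0; first exact: lgen_one.
  rewrite psiW; apply: lgen_mul => //; first by apply: lgen_principal => //; apply: W_neq0.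
  by have [] := hd l l0.
have Tt u1 v1 k1 : lgen m (T (z u1) (z v1) (z k1)) (t (u1 + v1) * t (u1 - v1) * (t k1 * t k1)).
  by rewrite /T zD zB; do ?[apply: lgen_mul => //].
have t0 l : t l != 0 by have [] := gt l.
have par u1 v1 k1 : smooth u1 \/ smooth v1 -> vunit (localization OK m)
    (t (u1 + v1) * t (u1 - v1) * (t k1 * t k1) / (t u1 * t v1 * t k1) ^+ 2).
  move=> h; have -> : t (u1 + v1) * t (u1 - v1) * (t k1 * t k1) / (t u1 * t v1 * t k1) ^+ 2
     = t (u1 + v1) * t (u1 - v1) / (t u1 ^+ 2 * t v1 ^+ 2) by field; rewrite !t0.
  apply: (net_quotient_parallelogram ha fD f0 fC netW hm hden).
  by case: h => h; [left | right]; apply: h.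
(* The symmetric expression generates both ideals locally: by [par] it differs from each natural
   generator by a unit. *)
exists ((t u * t v * t k) ^+ 2); split.
  apply: lgen_unit (Tt u v k) (par u v k s) => //; exact/Tsub/zlin_Zadjoin.
rewrite perm; apply: lgen_unit (Tt u' v' k') (par u' v' k' s') => //.
exact/Tsub/zlin_Zadjoin.
Qed.
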